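(* Let $\mathcal{H}$ be a Hilbert space, let $m$ be a natural number and let $c>1$ be a fixed real number (used in the definition of $P(m,\eta,d)$). Let $\Gamma$ be a group generated by $S=\{s_1,\dots,s_m,s_1^{-1},\dots,s_m^{-1}\}$, and for $P=(S,R)\in P(m,\eta,d)$ let $\Gamma_P'=\Gamma/\overline{R}$, where $\overline{R}$ denotes the normal closure of the subset of $\Gamma$ determined by $R$. If $1/3<d<1$, then $$\lim_{\eta\to\infty}\frac{\#\{P\in P(m,\eta,d)\mid\Gamma_P'\text{ has }F(\mathcal{H})\}}{\#P(m,\eta,d)}=1.$$
   Context: Let $m,\eta\ge1$ be natural numbers and $0<d<1$ a real number. Regard $S=\{s_1,s_1^{-1},\dots,s_m,s_m^{-1}\}$ as a set of $2m$ letters (formal symbols, which may become equal or trivial in $\Gamma$, with $s_i^{-1}$ representing the inverse of $s_i$). A word of length $\eta$ is a sequence of $\eta$ letters of $S$, not necessarily reduced; $W_\eta$ is the set of all words of length $\eta$, so $\#W_\eta=(2m)^\eta$. Each word determines an element of $\Gamma$. Fix a real number $c>1$ and set $$P(m,\eta,d)=\{P=(S,R)\mid R\subset W_\eta,\ c^{-1}(2m)^{d\eta}\le\#R\le c(2m)^{d\eta}\}.$$ For a metric space $Y$, a group $G$ has $F(Y)$ if for every homomorphism $\rho:G\to\mathrm{Isom}(Y)$ ($\mathrm{Isom}(Y)$ the group of isometries of $Y$) there is $p\in Y$ with $\rho(\gamma)p=p$ for all $\gamma\in G$. *)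

(* Defs.v *)
From HB Require Import structures.
From mathcomp Require Import all_boot all_order all_algebra.
From mathcomp Require Import all_classical all_reals all_analysis.

Set Implicit Arguments.
Unset Strict Implicit.
Unset Printing Implicit Defensive.

Import Order.TTheory GRing.Theory Num.Theory.
Import numFieldNormedType.Exports.

Local Open Scope classical_set_scope.
Local Open Scope ring_scope.
Local Open Scope group_scope.
Local Open Scope quotient_scope.

Section Subgroups.
Variable G : groupType.

Definition subgroup (N : set G) : Prop :=
  [/\ N 1, forall x y, N x -> N y -> N (x * y) & forall x, N x -> N x^-1].

Definition normal_subgroup (N : set G) : Prop :=
  subgroup N /\ forall x g, N x -> N (x ^ g).

Definition generates (A : set G) : Prop := smallest subgroup A = setT.

Definition normal_closure (A : set G) : set G := smallest normal_subgroup A.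

Lemma normal_closureP (A : set G) : normal_subgroup (normal_closure A).
Proof.
split; [split|].
- by move=> N [[[? _ _] _] _].
- move=> x y Nx Ny N HN; case: (HN) => -[[_ NM _] _] _.
  by apply: NM; [exact: Nx|exact: Ny].
- by move=> x Nx N HN; case: (HN) => -[[_ _ NV] _] _; apply: NV; exact: Nx.
- by move=> x g Nx N HN; case: (HN) => -[_ NJ] _; apply: NJ; exact: Nx.
Qed.

End Subgroups.

Section QuotientByNormalClosure.
Variables (G : groupType) (A : set G).
Local Notation N := (normal_closure A).

Let N1 : N 1. Proof. by have [[]] := normal_closureP A. Qed.
Let NM x y : N x -> N y -> N (x * y).
Proof. by have [[_ + _] _] := normal_closureP A; apply. Qed.
Let NV x : N x -> N x^-1.
Proof. by have [[_ _ +] _] := normal_closureP A; apply. Qed.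
Let NJ x g : N x -> N (x ^ g).
Proof. by have [_ +] := normal_closureP A; apply. Qed.

Definition coset_rel : rel G := fun x y => `[< N (x^-1 * y) >].

Let coset_rel_refl : reflexive coset_rel.
Proof. by move=> x; apply/asboolP; rewrite mulVg. Qed.

Let coset_rel_sym : symmetric coset_rel.
Proof. by move=> x y; apply/asboolP/asboolP => /NV; rewrite invgM invgK. Qed.

Let coset_rel_trans : transitive coset_rel.
Proof.
move=> y x z /asboolP xy /asboolP yz; apply/asboolP.
by have := NM xy yz; rewrite -mulgA mulVKg.
Qed.

Canonical coset_equiv :=
  EquivRel coset_rel coset_rel_refl coset_rel_sym coset_rel_trans.

Definition quotient_group : Type := {eq_quot coset_equiv}.

HB.instance Definition _ := Choice.on quotient_group.

Definition quotient_map (x : G) : quotient_group := \pi_{eq_quot coset_equiv} x.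

Definition quotient_repr (x : quotient_group) : G :=
  repr (x : {eq_quot coset_equiv}).

Lemma quotient_reprK : cancel quotient_repr quotient_map.
Proof. by move=> x; exact: reprK. Qed.

Lemma quotient_mapP x y :
  quotient_map x = quotient_map y <-> N (x^-1 * y).
Proof.
have e := @eqmodP G coset_equiv x y.
by split=> [/e/asboolP|/asboolP/e].
Qed.

Definition quotient_one : quotient_group := quotient_map 1.
Definition quotient_mul (x y : quotient_group) : quotient_group :=
  quotient_map (quotient_repr x * quotient_repr y).
Definition quotient_inv (x : quotient_group) : quotient_group :=
  quotient_map (quotient_repr x)^-1.

Let repr_map x : N (x^-1 * quotient_repr (quotient_map x)).
Proof. by apply/quotient_mapP; rewrite quotient_reprK. Qed.

Lemma quotient_mapM x y :
  quotient_map (x * y) = quotient_mul (quotient_map x) (quotient_map y).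
Proof.
apply/quotient_mapP.
set x' := quotient_repr _; set y' := quotient_repr _.
have -> : (x * y)^-1 * (x' * y') = (x^-1 * x') ^ y * (y^-1 * y').
  by rewrite /conjg invgM !mulgA mulgK.
by apply: NM; [apply: NJ|]; exact: repr_map.
Qed.

Lemma quotient_mapV x : quotient_map x^-1 = quotient_inv (quotient_map x).
Proof.
apply/quotient_mapP; set x' := quotient_repr _.
have -> : x^-1^-1 * x'^-1 = (x^-1 * x')^-1 ^ x^-1.
  by rewrite /conjg invgK invgM invgK -!mulgA mulgV mulg1.
by apply: NJ; apply: NV; exact: repr_map.
Qed.

Let quotient_mulA : associative quotient_mul.
Proof.
move=> x y z; rewrite -[x]quotient_reprK -[y]quotient_reprK -[z]quotient_reprK.
by rewrite -!quotient_mapM mulgA.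
Qed.

Let quotient_mul1 : left_id quotient_one quotient_mul.
Proof. by move=> x; rewrite -[x]quotient_reprK -quotient_mapM mul1g. Qed.

Let quotient_mulr1 : right_id quotient_one quotient_mul.
Proof. by move=> x; rewrite -[x]quotient_reprK -quotient_mapM mulg1. Qed.

Let quotient_mulV : left_inverse quotient_one quotient_inv quotient_mul.
Proof.
by move=> x; rewrite -[x]quotient_reprK -quotient_mapV -quotient_mapM mulVg.
Qed.

Let quotient_mulrV : right_inverse quotient_one quotient_inv quotient_mul.
Proof.
by move=> x; rewrite -[x]quotient_reprK -quotient_mapV -quotient_mapM mulgV.
Qed.

HB.instance Definition _ := isGroup.Build quotient_group
  quotient_mulA quotient_mul1 quotient_mulr1 quotient_mulV quotient_mulrV.

End QuotientByNormalClosure.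

Section Isometries.
Variables (R : numDomainType) (Y : metricType R).

Record Isom : Type := Isometry {
  isometry_fun :> Y -> Y;
  isometry_bij : bijective isometry_fun;
  isometry_mdist : forall x y,
    mdist (isometry_fun x) (isometry_fun y) = mdist x y
}.

Lemma isometryP (f g : Isom) : f =1 g -> f = g.
Proof.
case: f g => [f bf df] [g bg dg] /= /funext fg; rewrite -{}fg in bg dg *.
by rewrite (Prop_irrelevance bf bg) (Prop_irrelevance df dg).
Qed.

HB.instance Definition _ := gen_eqMixin Isom.
HB.instance Definition _ := gen_choiceMixin Isom.

Definition isometry_id : Isom :=
  @Isometry id (Bijective (fun=> erefl) (fun=> erefl)) (fun _ _ => erefl).

Let comp_mdist (f g : Isom) x y :
  mdist ((f \o g) x) ((f \o g) y) = mdist x y.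
Proof. by rewrite /= !isometry_mdist. Qed.

Definition isometry_comp (f g : Isom) : Isom :=
  Isometry (bij_comp (isometry_bij f) (isometry_bij g)) (comp_mdist f g).

Let inverse (f : Isom) : {g : Y -> Y | cancel f g /\ cancel g f}.
Proof. by apply: cid; case: (isometry_bij f) => g; exists g. Qed.

Let inv_bij (f : Isom) : bijective (sval (inverse f)).
Proof. by case: (inverse f) => g /= [fK gK]; exists f. Qed.

Let inv_mdist (f : Isom) x y :
  mdist (sval (inverse f) x) (sval (inverse f) y) = mdist x y.
Proof. by case: (inverse f) => g /= [_ gK]; rewrite -(isometry_mdist f) !gK. Qed.

Definition isometry_inv (f : Isom) : Isom :=
  Isometry (inv_bij f) (@inv_mdist f).

Let isometry_compA : associative isometry_comp.
Proof. by move=> f g h; exact: isometryP. Qed.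
Let isometry_comp1 : left_id isometry_id isometry_comp.
Proof. by move=> f; exact: isometryP. Qed.
Let isometry_compr1 : right_id isometry_id isometry_comp.
Proof. by move=> f; exact: isometryP. Qed.
Let isometry_compV : left_inverse isometry_id isometry_inv isometry_comp.
Proof.
by move=> f; apply: isometryP => x /=; case: (inverse f) => g /= [].
Qed.
Let isometry_comprV : right_inverse isometry_id isometry_inv isometry_comp.
Proof.
by move=> f; apply: isometryP => x /=; case: (inverse f) => g /= [].
Qed.

HB.instance Definition _ := isGroup.Build Isom
  isometry_compA isometry_comp1 isometry_compr1 isometry_compV isometry_comprV.

End Isometries.

(* A multiplicative map between groups is a group homomorphism. *)
Definition has_F (G : groupType) (R : numDomainType) (Y : metricType R) : Prop :=
  forall rho : {multiplicative G -> Isom Y},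
    exists p : Y, forall g : G, rho g p = p.

(* MathComp-Analysis does not equip a normed module with the metricType
   structure of its norm; this alias does. *)
Definition normed_metric (R : numFieldType) (V : normedModType R) : Type := V.

Section NormedMetric.
Variables (R : numFieldType) (V : normedModType R).
Let T := normed_metric V.

HB.instance Definition _ := PseudoMetric.copy T V.

Let dist (x y : T) : R := `|(y : V) - (x : V)|%R.

Let dist_ge0 x y : (0 <= dist x y)%R.
Proof. exact: normr_ge0. Qed.

Let dist_positivity x y : dist x y = 0%R -> x = y.
Proof. by move/normr0_eq0/eqP; rewrite subr_eq0 => /eqP. Qed.

Let ballE (x : T) d : ball x d = [set y | (dist x y < d)%R].
Proof.
rewrite -[LHS]/(ball (x : V) d) -ball_normE.
by apply/seteqP; split=> y /=; rewrite /dist distrC.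
Qed.

HB.instance Definition _ :=
  @PseudoMetric_isMetric.Build R T dist dist_ge0 dist_positivity ballE.
End NormedMetric.

(* Scalars are real. This covers complex Hilbert spaces: [has_F] sees only the
   metric, and the real part of a complex inner product is a real inner product
   with the same norm. *)
Definition hilbert (R : realType) (H : completeNormedModType R) : Prop :=
  exists dot : {dot H for idfun}, forall x, dot x x = (`|x| ^+ 2)%R.

(* [(i, false)] is the letter s_i and [(i, true)] the letter s_i^-1; they are
   formal symbols, so there are 2m of them whatever their values in the group. *)
Definition letter (m : nat) : finType := ('I_m * bool)%type.

Definition word (m eta : nat) : finType := (eta.-tuple (letter m))%type.

Section Words.
Variables (G : groupType) (m : nat) (s : 'I_m -> G).

Definition letter_value (a : letter m) : G :=
  if a.2 then (s a.1)^-1 else s a.1.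

Definition word_value (eta : nat) (w : word m eta) : G :=
  \prod_(a <- w) letter_value a.

(* the group Gamma / (normal closure of the values of the words in [Rel]) *)
Definition presented_quotient (eta : nat) (Rel : {set word m eta}) : groupType :=
  quotient_group [set word_value w | w in [set` Rel]].

End Words.

(* The generating letters being fixed, a presentation is its relator set. *)
Definition presentations (R : realType) (m eta : nat) (d c : R) :
    {set {set word m eta}} :=
  [set Rel : {set word m eta} |
    (c^-1 * (2 * m)%:R `^ (d * eta%:R) <= #|Rel|%:R
       <= c * (2 * m)%:R `^ (d * eta%:R))%R]%SET.

(* Main.v *)
Require Import Defs.
From mathcomp Require Import all_boot all_order all_algebra.
From mathcomp Require Import all_classical all_reals all_analysis.
From mathcomp Require Import fingroup perm ring lra zify.

Set Implicit Arguments.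
Unset Strict Implicit.
Unset Printing Implicit Defensive.

Import Order.TTheory GRing.Theory Num.Theory.
Import numFieldNormedType.Exports.

Local Open Scope classical_set_scope.
Local Open Scope ring_scope.

(** A relator of length 3l + 2t splits as abc with |a| = |c| = l and |b| = l + 2t,
    where t <= 2 depends on eta mod 3; every word of length l becomes a possible b
    after appending s s^-1 t times.
    For an isometric action on a Hilbert space and a point p, put f(w) = w p for
    words w of length l.  The relator says b f(c) = f(a^-1).  Let p' be the mean
    of f.  If the two random bipartite graphs with edges (b, c) and (b, a^-1) have
    a strong spectral gap and all b have large degree, then averaging this relation
    over the relators with middle part b gives b p' ~ p', so p |-> p' contracts the
    energy sum_w |w p - p|^2 by a factor 4, and its iterates converge to a point
    fixed by all words of length l.

    The gap needs average degree n^eps, n = (2m)^l, which is what d > 1/3 provides.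
    Cut the relators into L independent batches and let A = A_1 + ... + A_L be the
    centred adjacency operator.  In A^r the products with distinct indices have
    expected squared Frobenius norm at most n (1/degree)^r relative to degree^(2r),
    as each factor is centred and independent of the others; for r > 1/eps this
    tends to 0.  The products with a repeated index form a fraction at most r^2/L
    and are bounded by the maximal degree.  As A is symmetric, a bound on A^r with r
    a power of 2 bounds A.

    Independent uniform relators are compared with a uniform set of relators of
    prescribed size through a uniform permutation of the words, since forcing a
    fixed point is monotone in the set of relators. *)

(** * Operators on Hilbert space valued functions *)

(** Definiteness is kept apart, as the hypothesis [dot_def] under which isometries are shown to be
    affine. *)
Record inner_product (R : realFieldType) (H : lmodType R) := InnerProduct {
  ip :> H -> H -> R;
  ipC : forall x y, ip x y = ip y x;
  ipDl : forall x y z, ip (x + y) z = ip x z + ip y z;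
  ipZl : forall a x y, ip (a *: x) y = a * ip x y;
  ip_ge0 : forall x, 0 <= ip x x
}.

Section InnerProduct.
Variables (R : realFieldType) (H : lmodType R) (dot : inner_product H).

Lemma ipDr x y z : dot x (y + z) = dot x y + dot x z.
Proof. by rewrite ipC ipDl !(ipC dot x). Qed.
Lemma ipZr a x y : dot x (a *: y) = a * dot x y.
Proof. by rewrite ipC ipZl ipC. Qed.
Lemma ip0l x : dot 0 x = 0.
Proof. by rewrite -(scale0r 0) ipZl mul0r. Qed.
Lemma ipNl x y : dot (- x) y = - dot x y.
Proof. by rewrite -scaleN1r ipZl mulN1r. Qed.
Lemma ipNr x y : dot x (- y) = - dot x y.
Proof. by rewrite ipC ipNl ipC. Qed.
Definition ipE := (ipDl, ipDr, ipNl, ipNr, ipZl, ipZr).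

Lemma ip_suml I (r : seq I) (P : pred I) (F : I -> H) y :
  dot (\sum_(i <- r | P i) F i) y = \sum_(i <- r | P i) dot (F i) y.
Proof.
elim/big_rec2: _ => [|i a b _ <-]; first exact: ip0l.
by rewrite ipDl.
Qed.

Lemma ip_sumr I (r : seq I) (P : pred I) (F : I -> H) y :
  dot y (\sum_(i <- r | P i) F i) = \sum_(i <- r | P i) dot y (F i).
Proof. by rewrite ipC ip_suml; apply: eq_bigr => i _; rewrite ipC. Qed.

Local Notation nsq x := (dot x x).

Lemma nsqD_le x y : nsq (x + y) <= 2 * nsq x + 2 * nsq y.
Proof.
have := ip_ge0 dot (x - y).
rewrite !ipE (ipC dot y x) => ?; lra.
Qed.

Lemma nsqN x : nsq (- x) = nsq x.
Proof. by rewrite ipNl ipNr opprK. Qed.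

Lemma nsqZ a x : nsq (a *: x) = a ^+ 2 * nsq x.
Proof. by rewrite ipZl ipZr; ring. Qed.

(* Lagrange's identity, in the form sum_{i,j} |k_i g_j - k_j g_i|^2 >= 0. *)
Lemma nsq_sum_le I (r : seq I) (P : pred I) (k : I -> R) (g : I -> H) :
  nsq (\sum_(i <- r | P i) k i *: g i) <=
  (\sum_(i <- r | P i) k i ^+ 2) * \sum_(i <- r | P i) nsq (g i).
Proof.
set S := \sum_(i <- r | P i) k i *: g i.
set K := \sum_(i <- r | P i) k i ^+ 2; set G := \sum_(i <- r | P i) nsq (g i).
have : 0 <= \sum_(i <- r | P i) \sum_(j <- r | P j)
   nsq (k i *: g j - k j *: g i).
  by apply: sumr_ge0 => i _; apply: sumr_ge0 => j _; apply: ip_ge0.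
have -> : \sum_(i <- r | P i) \sum_(j <- r | P j) nsq (k i *: g j - k j *: g i)
  = \sum_(i <- r | P i) (k i ^+ 2 * G + K * nsq (g i)
       - 2 * dot (k i *: g i) S).
  apply: eq_bigr => i _.
  rewrite ip_sumr !mulr_sumr mulr_suml -big_split /= -sumrB.
  apply: eq_bigr => j _.
  rewrite !ipE (ipC dot (g j)); ring.
rewrite sumrB big_split /= -mulr_suml -!mulr_sumr -/K -/G -ip_suml -/S => ?; lra.
Qed.

(** Jensen's inequality: twice the difference of the sides is sum_{i,j} a_i a_j |g_j - g_i|^2 >=
    0. *)
Lemma nsq_wsum_le I (r : seq I) (P : pred I) (a : I -> R) (g : I -> H) :
  (forall i, P i -> 0 <= a i) ->
  nsq (\sum_(i <- r | P i) a i *: g i) <=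
  (\sum_(i <- r | P i) a i) * \sum_(i <- r | P i) a i * nsq (g i).
Proof.
move=> a_ge0.
set S := \sum_(i <- r | P i) a i *: g i.
set K := \sum_(i <- r | P i) a i; set G := \sum_(i <- r | P i) a i * nsq (g i).
have : 0 <= \sum_(i <- r | P i) \sum_(j <- r | P j)
   a i * a j * nsq (g j - g i).
  apply: sumr_ge0 => i Pi; apply: sumr_ge0 => j Pj.
  by rewrite !mulr_ge0 ?a_ge0 ?ip_ge0.
have -> : \sum_(i <- r | P i) \sum_(j <- r | P j) a i * a j * nsq (g j - g i)
  = \sum_(i <- r | P i) (a i * G + K * (a i * nsq (g i)) - 2 * dot (a i *: g i) S).
  apply: eq_bigr => i _.
  rewrite ip_sumr !mulr_sumr mulr_suml -big_split /= -sumrB.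
  apply: eq_bigr => j _.
  rewrite !ipE (ipC dot (g j)); ring.
rewrite sumrB big_split /= -mulr_suml -!mulr_sumr -/K -/G -ip_suml -/S => ?; lra.
Qed.

Lemma nsq_sum_card_le I (r : seq I) (g : I -> H) :
  nsq (\sum_(i <- r) g i) <= (size r)%:R * \sum_(i <- r) nsq (g i).
Proof.
have := nsq_sum_le r xpredT (fun=> 1) g.
under eq_bigr do rewrite scale1r.
by rewrite expr1n big_const_seq count_predT iter_addr_0.
Qed.

End InnerProduct.

Section Operators.
Variables (R : realFieldType) (V : finType).
Implicit Types A B : V -> V -> R.

(** Kernels are scalar while functions take values in [H], so that one bound on a random matrix
    serves every action on every Hilbert space. *)
Definition opv (H : lmodType R) A (g : V -> H) (v : V) : H :=
  \sum_w A v w *: g w.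

Definition mulk A B (v w : V) : R := \sum_x A v x * B x w.

Definition idk (v w : V) : R := (v == w)%:R.

Lemma opv_mulk (H : lmodType R) A B (g : V -> H) :
  opv (mulk A B) g =1 opv A (opv B g).
Proof.
move=> v; rewrite /opv /mulk.
under eq_bigr do rewrite scaler_suml.
rewrite exchange_big; apply: eq_bigr => x _ /=.
by rewrite scaler_sumr; apply: eq_bigr => w _; rewrite scalerA.
Qed.

Lemma opv_idk (H : lmodType R) (g : V -> H) : opv idk g =1 g.
Proof.
move=> v; rewrite /opv (bigD1 v) //= /idk eqxx scale1r big1 ?addr0 // => w.
by rewrite eq_sym => /negPf ->; rewrite scale0r.
Qed.

Lemma eq_opv (H : lmodType R) A (g h : V -> H) : g =1 h -> opv A g =1 opv A h.
Proof. by move=> gh v; apply: eq_bigr => w _; rewrite gh. Qed.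

Definition prodk (I : Type) (A : I -> V -> V -> R) (u : seq I) :=
  foldr (fun i => mulk (A i)) idk u.

Definition frobsq A := \sum_v \sum_w A v w ^+ 2.

Lemma frobsq_ge0 A : 0 <= frobsq A.
Proof. by apply: sumr_ge0 => v _; apply: sumr_ge0 => w _; apply: sqr_ge0. Qed.

Variables (H : lmodType R) (dot : inner_product H).
Implicit Types g h : V -> H.

Definition nsqf g := \sum_v dot (g v) (g v).
Definition ipf g h := \sum_v dot (g v) (h v).

Lemma nsqf_ge0 g : 0 <= nsqf g.
Proof. by apply: sumr_ge0 => v _; apply: ip_ge0. Qed.

Lemma eq_nsqf g h : g =1 h -> nsqf g = nsqf h.
Proof. by move=> gh; apply: eq_bigr => v _; rewrite gh. Qed.

Lemma nsqf_opv_frob A g : nsqf (opv A g) <= frobsq A * nsqf g.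
Proof.
rewrite /frobsq mulr_suml; apply: ler_sum => v _; exact: nsq_sum_le.
Qed.

(** Schur's test: Jensen along each row, then exchange the sums; symmetry turns column sums into row
    sums. *)
Lemma nsqf_opv_schur A (D : R) g :
  (forall v w, 0 <= A v w) -> (forall v w, A v w = A w v) ->
  (forall v, \sum_w A v w <= D) ->
  nsqf (opv A g) <= D ^+ 2 * nsqf g.
Proof.
move=> A_ge0 A_sym A_deg.
have A2 v : 0 <= \sum_w A v w * dot (g w) (g w).
  by apply: sumr_ge0 => w _; rewrite mulr_ge0 ?ip_ge0.
apply: (@le_trans _ _ (\sum_v D * \sum_w A v w * dot (g w) (g w))).
  apply: ler_sum => v _; apply: le_trans (nsq_wsum_le _ _ _ _) _ => //.
  by rewrite ler_wpM2r.
rewrite -mulr_sumr exchange_big /= expr2 -mulrA.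
(* A vertex is needed to know [0 <= D]; without one both sides vanish. *)
have [v0|no_v] := pickP V; last first.
  by rewrite /nsqf !big_pred0 ?mulr0.
have D_ge0 : 0 <= D by apply: le_trans (A_deg v0); apply: sumr_ge0.
rewrite ler_wpM2l // mulr_sumr; apply: ler_sum => w _.
rewrite -mulr_suml ler_wpM2r ?ip_ge0 //.
by under eq_bigr do rewrite A_sym.
Qed.

Lemma ipf_opv_sym A g h :
  (forall v w, A v w = A w v) -> ipf (opv A g) h = ipf g (opv A h).
Proof.
move=> A_sym; rewrite /ipf /opv.
under eq_bigr do rewrite ip_suml.
rewrite exchange_big; apply: eq_bigr => w _ /=.
rewrite ip_sumr; apply: eq_bigr => v _.
by rewrite ipZl ipZr A_sym.
Qed.

(* Expand |A^2 g - lam g|^2 >= 0. *)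
Lemma nsqf_opv_sqrt A (lam : R) g : 0 < lam -> (forall v w, A v w = A w v) ->
  nsqf (opv A (opv A g)) <= lam ^+ 2 * nsqf g -> nsqf (opv A g) <= lam * nsqf g.
Proof.
move=> lam_gt0 A_sym.
have : 0 <= nsqf (fun v => opv A (opv A g) v - lam *: g v) by exact: nsqf_ge0.
have -> : nsqf (fun v => opv A (opv A g) v - lam *: g v) =
  nsqf (opv A (opv A g)) - 2 * lam * nsqf (opv A g) + lam ^+ 2 * nsqf g.
  have -> : nsqf (opv A g) = ipf (opv A (opv A g)) g by rewrite ipf_opv_sym.
  rewrite /nsqf /ipf !mulr_sumr -sumrB -big_split; apply: eq_bigr => v _ /=.
  rewrite !ipE (ipC dot (g v)); ring.
move=> h1 h2; rewrite -(ler_pM2l lam_gt0); nra.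
Qed.

Lemma iter_mulk_sym A n : (forall v w, A v w = A w v) ->
  forall v w, iter n (mulk A) idk v w = iter n (mulk A) idk w v.
Proof.
move=> A_sym.
(* Transposing puts [A] on the right of its power, so it has to be commuted back to the left. *)
have comm k v w : mulk A (iter k (mulk A) idk) v w
  = mulk (iter k (mulk A) idk) A v w.
  elim: k v w => [|k IH] v w /=.
    rewrite /mulk /idk (bigD1 w) //= eqxx mulr1 big1 ?addr0; last first.
      by move=> x /negPf ->; rewrite mulr0.
    rewrite (bigD1 v) //= eqxx mul1r big1 ?addr0 // => x.
    by rewrite eq_sym => /negPf ->; rewrite mul0r.
  rewrite {1}/mulk; under eq_bigr do rewrite IH.
  rewrite /mulk; under eq_bigr do rewrite mulr_sumr.
  rewrite exchange_big /=; apply: eq_bigr => y _; rewrite mulr_suml.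
  by apply: eq_bigr => x _; rewrite mulrA.
elim: n => [|n IH] v w /=; first by rewrite /idk eq_sym.
rewrite comm /mulk; apply: eq_bigr => x _.
by rewrite IH A_sym mulrC.
Qed.

Lemma opv_iter_mulk A n g : opv (iter n (mulk A) idk) g =1 iter n (opv A) g.
Proof.
elim: n => [|n IH] v /=; first exact: opv_idk.
by rewrite opv_mulk; apply: eq_opv.
Qed.

(** [lam] bounds the squared operator norm. Powers of a symmetric kernel are symmetric, so
    [nsqf_opv_sqrt] can halve the exponent [s] times. *)
Lemma nsqf_opv_root A (lam : R) (s : nat) :
  0 < lam -> (forall v w, A v w = A w v) ->
  (forall g, nsqf (iter (2 ^ s) (opv A) g) <= lam ^+ (2 ^ s) * nsqf g) ->
  forall g, nsqf (opv A g) <= lam * nsqf g.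
Proof.
move=> lam_gt0 A_sym; elim: s => [|s IH]; first by rewrite expn0 expr1.
move=> h; apply: IH => g.
rewrite -(eq_nsqf (opv_iter_mulk A (2 ^ s) g)).
apply: nsqf_opv_sqrt; rewrite ?exprn_gt0 //; first exact: iter_mulk_sym.
have -> : nsqf (opv (iter (2 ^ s) (mulk A) idk)
    (opv (iter (2 ^ s) (mulk A) idk) g)) = nsqf (iter (2 ^ s.+1) (opv A) g).
  apply: eq_nsqf => v; rewrite opv_iter_mulk expnS mul2n -addnn iterD.
  suff {v}: forall n h1 h2, h1 =1 h2 -> iter n (opv A) h1 =1 iter n (opv A) h2.
    by apply; apply: opv_iter_mulk.
  by elim=> //= n IHn h1 h2 h12; apply: eq_opv; apply: IHn.
by rewrite -exprM -expnSr.
Qed.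

End Operators.

(** * Powers of a sum of operators *)

Section BatchPower.
Variables (R : realFieldType) (V : finType) (L : nat).
Variable A : 'I_L -> V -> V -> R.

Fixpoint seqs (n : nat) : seq (seq 'I_L) :=
  if n is n'.+1 then [seq i :: u | i <- enum 'I_L, u <- seqs n'] else [:: [::]].

Lemma size_seqs n : size (seqs n) = (L ^ n)%N.
Proof. by elim: n => //= n IH; rewrite size_allpairs IH size_enum_ord expnS. Qed.

Lemma size_in_seqs n u : u \in seqs n -> size u = n.
Proof.
elim: n u => [|n IH] u /=; first by rewrite inE => /eqP ->.
by case/allpairsP => -[i v] /= [_ /IH <- ->].
Qed.

(** Induction on [n]: [i :: u] repeats an index only if [u] does or [i] is among the [n] entries of
    [u], which adds a fraction n / L. *)
Lemma count_nonuniq_seqs n :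
  (L * count (predC uniq) (seqs n) <= n ^ 2 * L ^ n)%N.
Proof.
elim: n => [|n IH] //=; first by rewrite muln0.
rewrite count_flatten -map_comp sumnE big_map /=.
have -> : (\sum_(i <- enum 'I_L)
    count (predC uniq) [seq i :: u | u <- seqs n] =
    \sum_(u <- seqs n) \sum_(i < L) ((i \in u) || ~~ uniq u))%N.
  rewrite [RHS]exchange_big big_enum /=; apply: eq_big => // i _.
  rewrite count_map -sum1_count big_mkcond; apply: eq_bigr => u _ /=.
  by rewrite negb_and negbK; case: (_ || _).
have le u : u \in seqs n ->
  (\sum_(i < L) ((i \in u) || ~~ uniq u) <= n + L * ~~ uniq u)%N.
  move=> /size_in_seqs <-.
  have [_|_] := boolP (uniq u); last first.
    under eq_bigr do rewrite orbT.
    by rewrite sum_nat_const card_ord /= muln1 leq_addl.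
  under eq_bigr do rewrite orbF.
  rewrite muln0 addn0 (eq_bigr (fun i => if i \in u then 1 else 0)%N).
    by rewrite -big_mkcond sum1_card card_size.
  by move=> i _; case: (_ \in _).
have : (\sum_(u <- seqs n) \sum_(i < L) ((i \in u) || ~~ uniq u) <=
  \sum_(u <- seqs n) (n + L * ~~ uniq u))%N.
  by rewrite big_seq [X in (_ <= X)%N]big_seq; apply: leq_sum.
rewrite big_split /= -big_distrr /=.
have -> : (\sum_(u <- seqs n) ~~ uniq u)%N = count (predC uniq) (seqs n).
  by rewrite -sum1_count [RHS]big_mkcond; apply: eq_bigr => u _ /=; case: uniq.
rewrite big_const_seq count_predT iter_addn_0 size_seqs.
set c := count _ _ in IH *; set x := bigop _ _ _ => h.
have : (L * x <= L * (n * L ^ n + n ^ 2 * L ^ n))%N.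
  by rewrite leq_mul2l (leq_trans h) ?orbT // leq_add2l.
move/leq_trans; apply; rewrite [(L ^ _.+1)%N]expnS mulnCA -mulnDl.
by rewrite !leq_mul // -!mulnn; nia.
Qed.

Variables (H : lmodType R) (dot : inner_product H).

Lemma iter_opv_sum n (g : V -> H) v :
  iter n (opv (fun v w => \sum_i A i v w)) g v =
  \sum_(u <- seqs n) opv (prodk A u) g v.
Proof.
elim: n v => [|n IH] v /=; first by rewrite big_seq1 opv_idk.
rewrite (eq_opv _ IH) big_allpairs_dep big_enum /=.
rewrite {1}/opv /=; under eq_bigr => w _ do rewrite scaler_suml.
rewrite exchange_big; apply: eq_big => // i _ /=.
under [RHS]eq_bigr => u _ do rewrite opv_mulk /opv.
rewrite exchange_big; apply: eq_bigr => w _ /=.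
by rewrite scaler_sumr.
Qed.

Lemma nsqf_prodk (D : R) (g : V -> H) u : 0 <= D ->
  (forall i g, nsqf dot (opv (A i) g) <= D * nsqf dot g) ->
  nsqf dot (opv (prodk A u) g) <= D ^+ size u * nsqf dot g.
Proof.
move=> D_ge0 AD; elim: u => [|i u IH] /=.
  by rewrite expr0 mul1r (eq_nsqf _ (opv_idk g)).
rewrite (eq_nsqf _ (opv_mulk _ _ _)); apply: le_trans (AD _ _) _.
by rewrite exprS -mulrA ler_wpM2l.
Qed.

(** Expand the power into L^n products, at the cost L^n of Cauchy-Schwarz. Products of distinct
    factors are measured by Frobenius norms; those with a repeated index, being few, by the bound
    [D] on each factor. *)
Lemma nsqf_iter_le n (D : R) (g : V -> H) : (0 < L)%N -> 0 <= D ->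
  (forall i g, nsqf dot (opv (A i) g) <= D * nsqf dot g) ->
  nsqf dot (iter n (opv (fun v w => \sum_i A i v w)) g) <=
  L%:R ^+ n * (\sum_(u <- seqs n | uniq u) frobsq (prodk A u)
     + n%:R ^+ 2 * L%:R ^+ n / L%:R * D ^+ n) * nsqf dot g.
Proof.
move=> L_gt0 D_ge0 AD.
rewrite (eq_nsqf _ (iter_opv_sum n g)).
apply: (@le_trans _ _ (L%:R ^+ n * \sum_(u <- seqs n) nsqf dot (opv (prodk A u) g))).
  rewrite -natrX -size_seqs exchange_big /= mulr_sumr; apply: ler_sum => v _.
  exact: nsq_sum_card_le.
rewrite -mulrA ler_wpM2l ?exprn_ge0 // mulrDl mulr_suml.
rewrite (bigID uniq) /= lerD //.
  by apply: ler_sum => u _; apply: nsqf_opv_frob.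
apply: (@le_trans _ _ (\sum_(u <- seqs n | ~~ uniq u) D ^+ n * nsqf dot g)).
  rewrite big_seq_cond [leRHS]big_seq_cond; apply: ler_sum => u /andP[us _].
  by rewrite -{1}(size_in_seqs us); apply: nsqf_prodk.
rewrite big_const_seq iter_addr_0 -[leLHS]mulr_natl mulrA.
rewrite ler_wpM2r ?nsqf_ge0 // ler_wpM2r ?exprn_ge0 //.
rewrite ler_pdivlMr ?ltr0n // -!natrX -!natrM ler_nat mulnC.
exact: count_nonuniq_seqs.
Qed.

End BatchPower.

(** * Isometric actions and the contraction of energy *)

Section IsometryAffine.
Variables (R : realFieldType) (H : lmodType R) (dot : inner_product H).
Hypothesis dot_def : forall x, dot x x = 0 -> x = 0.
Variable f : H -> H.
Hypothesis f_isom : forall x y, dot (f x - f y) (f x - f y) = dot (x - y) (x - y).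

Definition linpart x := f x - f 0.

Lemma linpart_nsq x : dot (linpart x) (linpart x) = dot x x.
Proof. by rewrite f_isom subr0. Qed.

Lemma linpart_ip x y : dot (linpart x) (linpart y) = dot x y.
Proof.
have : dot (linpart x - linpart y) (linpart x - linpart y) = dot (x - y) (x - y).
  by rewrite /linpart opprB addrA subrK f_isom.
move: (linpart_nsq x) (linpart_nsq y); move: (linpart x) (linpart y) => u v.
by rewrite !ipE (ipC dot v) (ipC dot y x); lra.
Qed.

(** Expanding |linpart z - a linpart x - b linpart y|^2 leaves only inner products, which [linpart]
    preserves, so its value is |z - a x - b y|^2 = 0. *)
Lemma linpart_comb a b x y z :
  z = a *: x + b *: y -> linpart z = a *: linpart x + b *: linpart y.
Proof.
move=> zE; apply/eqP; rewrite -subr_eq0; apply/eqP/dot_def.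
move: (linpart_ip z z) (linpart_ip z x) (linpart_ip z y) (linpart_ip x x).
move: (linpart_ip x y) (linpart_ip y y).
move: (linpart x) (linpart y) (linpart z) => u v w yy xy xx zy zx zz.
rewrite !ipE (ipC dot u w) (ipC dot v w) (ipC dot v u) yy xy xx zy zx zz zE.
rewrite !ipE (ipC dot y x); ring.
Qed.

Lemma linpartD x y : linpart (x + y) = linpart x + linpart y.
Proof.
by rewrite (@linpart_comb 1 1 x y) ?scale1r.
Qed.

Lemma linpart0 : linpart 0 = 0.
Proof. exact: subrr. Qed.

Lemma linpart_sum I (r : seq I) (P : pred I) (F : I -> H) :
  linpart (\sum_(i <- r | P i) F i) = \sum_(i <- r | P i) linpart (F i).
Proof. exact: (big_morph _ linpartD linpart0). Qed.

Lemma linpartZ a x : linpart (a *: x) = a *: linpart x.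
Proof.
by rewrite (@linpart_comb a 0 x 0) ?scale0r ?addr0.
Qed.

Lemma isom_linpart x y : f (x + y) = f x + linpart y.
Proof.
have : linpart (x + y) = linpart x + linpart y by exact: linpartD.
by rewrite {1 2}/linpart => /eqP; rewrite addrAC -subr_eq opprK subrK => /eqP.
Qed.

End IsometryAffine.

Section WordAction.
Variables (A : finType) (inv : A -> A) (T : Type) (act1 : A -> T -> T).

Definition wact (u : seq A) (x : T) := foldr act1 x u.

Definition winv (u : seq A) := rev (map inv u).

Lemma wact_cat u v x : wact (u ++ v) x = wact u (wact v x).
Proof. exact: foldr_cat. Qed.

Hypothesis act1K : forall a x, act1 (inv a) (act1 a x) = x.

Lemma wact_invK u x : wact (winv u) (wact u x) = x.
Proof.
elim: u x => //= a u IH x.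
by rewrite /winv /= rev_cons -cats1 wact_cat /= act1K.
Qed.

Hypothesis invK : involutive inv.

Lemma winvK : involutive winv.
Proof. by move=> u; rewrite /winv map_rev revK mapK. Qed.

Lemma size_winv u : size (winv u) = size u.
Proof. by rewrite size_rev size_map. Qed.

End WordAction.

Section Contraction.
Variables (R : realFieldType) (H : lmodType R) (dot : inner_product H).
Hypothesis dot_def : forall x, dot x x = 0 -> x = 0.
Variables (A : finType) (inv : A -> A) (act1 : A -> H -> H).
Hypothesis act1K : forall a x, act1 (inv a) (act1 a x) = x.
Hypothesis act1_isom : forall a x y,
  dot (act1 a x - act1 a y) (act1 a x - act1 a y) = dot (x - y) (x - y).

Local Notation act := (wact act1).
Local Notation nsq x := (dot x x).

Lemma wact_isom u x y : nsq (act u x - act u y) = nsq (x - y).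
Proof. by elim: u => //= a u IH; rewrite act1_isom. Qed.

Variables (l l' : nat).
Local Notation Y := (l.-tuple A).
Local Notation X := (l'.-tuple A).

Definition energy p := \sum_(y : Y) nsq (act y p - p).
Definition orbit_mean p := #|{: Y}|%:R^-1 *: \sum_(y : Y) act y p.
Definition deviation p (y : Y) := act y p - orbit_mean p.

Hypothesis Y_gt0 : (0 < #|{: Y}|)%N.

Lemma sum_deviation p : \sum_y deviation p y = 0.
Proof.
rewrite /deviation sumrB sumr_const -scaler_nat scalerA.
by rewrite divff ?scale1r ?subrr // pnatr_eq0 -lt0n.
Qed.

(** Variance decomposition: the cross terms cancel because deviations from the mean sum to zero. *)
Lemma energy_deviation p : energy p =
  \sum_y nsq (deviation p y) + #|{: Y}|%:R * nsq (orbit_mean p - p).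
Proof.
have -> : energy p = \sum_y (nsq (deviation p y)
    + 2 * dot (deviation p y) (orbit_mean p - p) + nsq (orbit_mean p - p)).
  apply: eq_bigr => y _.
  rewrite -[act y p - p](subrKA (orbit_mean p)) -/(deviation p y).
  by move: (deviation p y) (orbit_mean p - p) => v u; rewrite !ipE (ipC dot u); ring.
rewrite !big_split /= -mulr_sumr -ip_suml sum_deviation ip0l mulr0 addr0.
by rewrite sumr_const mulr_natl.
Qed.

Lemma sum_deviation_le p : \sum_y nsq (deviation p y) <= energy p.
Proof. by rewrite energy_deviation lerDl mulr_ge0 ?ip_ge0. Qed.

(** Controls one step of the iteration by the energy, which makes the iterates Cauchy. *)
Lemma orbit_mean_dist p : nsq (orbit_mean p - p) <= energy p.
Proof.
rewrite energy_deviation -[leLHS]add0r lerD //.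
  by apply: sumr_ge0 => y _; apply: ip_ge0.
by rewrite ler_peMl ?ip_ge0 // ler1n.
Qed.

Variables (J : finType) (a c : J -> Y) (b : J -> X).
Hypothesis relator : forall j x, act (a j) (act (b j) (act (c j) x)) = x.
Variable ainv : J -> Y.
Hypothesis ainvE : forall j, ainv j = winv inv (a j) :> seq A.
Variable embed : Y -> X.
Hypothesis embed_inj : injective embed.
Hypothesis embed_act : forall y x, act (embed y) x = act y x.
Variables (Lam D : R).
Hypothesis D_gt0 : 0 < D.
Hypothesis D_le : forall w, D <= #|[pred j | b j == w]|%:R.
Hypothesis Lam_le : 16 * Lam <= D ^+ 2.
Hypothesis gap_c : forall g : Y -> H, \sum_y g y = 0 ->
  \sum_w nsq (\sum_(j | b j == w) g (c j)) <= Lam * \sum_y nsq (g y).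
Hypothesis gap_a : forall g : Y -> H, \sum_y g y = 0 ->
  \sum_w nsq (\sum_(j | b j == w) g (ainv j)) <= Lam * \sum_y nsq (g y).

(** A relator a b c with b = w gives w(c p) = a^-1 p. Write both orbit points as q plus a deviation:
    as w is affine, w q - q is the deviation at a^-1 minus the image under [linpart] of the
    deviation at c. Sum over the relators with middle part w, at least [D] in number. *)
Lemma relator_displacement p (w : X) :
  D ^+ 2 * nsq (act w (orbit_mean p) - orbit_mean p) <=
  2 * nsq (\sum_(j | b j == w) deviation p (ainv j)) +
  2 * nsq (\sum_(j | b j == w) deviation p (c j)).
Proof.
set q := orbit_mean p; set Jw := [pred j | b j == w].
have eq_j j : b j == w -> deviation p (ainv j) =
    act w q - q + linpart (act w) (deviation p (c j)).
  move=> /eqP bj; rewrite /deviation -/q addrAC; congr (_ - _).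
  rewrite -(isom_linpart dot_def (wact_isom w)) addrC subrK ainvE -bj.
  by rewrite -[in LHS](relator j p) (wact_invK act1K).
have eq_sum : (#|Jw|%:R : R) *: (act w q - q) =
  \sum_(j | b j == w) deviation p (ainv j)
  - linpart (act w) (\sum_(j | b j == w) deviation p (c j)).
  rewrite (linpart_sum dot_def (wact_isom w)) (eq_bigr _ eq_j) big_split /=.
  by rewrite sumr_const addrK scaler_nat.
apply: (@le_trans _ _ (nsq ((#|Jw|%:R : R) *: (act w q - q)))).
  by rewrite nsqZ ler_wpM2r ?ip_ge0 // ler_sqr ?nnegrE ?D_le // ltW.
rewrite eq_sum; apply: le_trans (nsqD_le _ _ _) _.
by rewrite nsqN (linpart_nsq (wact_isom w)).
Qed.

(** Summing [relator_displacement] over w, the two gaps bound the right side by 4 [Lam] times the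
    squared deviations, and [Lam_le] leaves a quarter of the energy. *)
Lemma energy_contract p : 4 * energy (orbit_mean p) <= energy p.
Proof.
have D2_gt0 : 0 < D ^+ 2 by rewrite exprn_gt0.
(* Displacements by words of length [l] occur among those by words of length [l'], through the
   injective [embed]. *)
have h1 : energy (orbit_mean p) <=
    \sum_(w : X) nsq (act w (orbit_mean p) - orbit_mean p).
  rewrite /energy.
  under eq_bigr do rewrite -embed_act.
  rewrite -(big_map embed xpredT
    (fun w : X => nsq (act w (orbit_mean p) - orbit_mean p))).
  rewrite big_uniq /=; last by rewrite map_inj_uniq ?index_enum_uniq.
  rewrite big_mkcond; apply: ler_sum => w _.
  by case: ifP => // _; apply: ip_ge0.
have : D ^+ 2 * (\sum_(w : X) nsq (act w (orbit_mean p) - orbit_mean p)) <=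
    4 * Lam * \sum_y nsq (deviation p y).
  rewrite mulr_sumr; apply: le_trans (ler_sum _ (fun w _ => relator_displacement p w)) _.
  rewrite big_split /= -!mulr_sumr.
  have := gap_a (sum_deviation p); have := gap_c (sum_deviation p); lra.
have e_ge0 : 0 <= \sum_y nsq (deviation p y).
  by apply: sumr_ge0 => y _; apply: ip_ge0.
have := sum_deviation_le p.
move: (\sum_y _) (\sum_(w : X) _) (energy p) (energy _) e_ge0 h1 => e x E E' e_ge0 h1 h2 h3.
rewrite -(ler_pM2l D2_gt0).
move: (D ^+ 2) Lam_le D2_gt0 h3 => D2 Lam_le' D2_gt0 h3.
have h4 : D2 * E' <= D2 * x by rewrite ler_pM2l.
have h5 : 16 * Lam * e <= D2 * e by rewrite ler_wpM2r.
have h6 : D2 * e <= D2 * E by rewrite ler_pM2l.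
lra.
Qed.

End Contraction.

(** * Convergence of the iteration to a fixed point *)

Section FixedPoint.
Variables (R : realType) (H : completeNormedModType R) (dot : inner_product H).
Hypothesis dot_norm : forall x, dot x x = `|x| ^+ 2.

(** The telescoping series converges absolutely, hence converges as [H] is complete. *)
Lemma geometric_cvg (p : nat -> H) (M : R) :
  (forall n, `|p n.+1 - p n| <= M * 2^-1 ^+ n) -> cvgn p.
Proof.
move=> p_geo.
have cs : cvgn (series (telescope p)).
  apply: normed_cvg; apply: (@series_le_cvg _ _ (geometric M 2^-1)) => [n|n|n|].
  - exact: normr_ge0.
  - by apply: le_trans (p_geo n); apply: normr_ge0.
  - exact: p_geo.
  - by apply: is_cvg_geometric_series; rewrite gtr0_norm ?invr_gt0 ?invf_lt1 ?ltr1n.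
have -> : p = (fun n => p 0%N + series (telescope p) n).
  by apply/funext => n; apply: eq_sum_telescope.
by apply: is_cvgD => //; apply: is_cvg_cst.
Qed.

Lemma norm_sqr_le (x : H) (r : R) : 0 <= r -> dot x x <= r ^+ 2 -> `|x| <= r.
Proof. by move=> r_ge0; rewrite dot_norm ler_sqr ?nnegrE. Qed.

Variables (I : finType) (T : I -> H -> H) (F : H -> H).
Hypothesis T_isom : forall i x y, `|T i x - T i y| = `|x - y|.
Local Notation E x := (\sum_i dot (T i x - x) (T i x - x)).
Hypothesis F_contract : forall x, 4 * E (F x) <= E x.
Hypothesis F_dist : forall x, dot (F x - x) (F x - x) <= E x.

Lemma contraction_fixpoint : exists p, forall i, T i p = p.
Proof.
(* The added 1 ensures [E 0 <= M ^+ 2]; dividing the energy by 4 halves the bound on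
   displacements. *)
pose p n := iter n F 0; pose M := E 0 + 1.
have E_ge0 x : 0 <= E x by apply: sumr_ge0 => i _; apply: ip_ge0.
have M_ge0 : 0 <= M by rewrite addr_ge0 ?E_ge0.
have E_p n : E (p n) <= (M * 2^-1 ^+ n) ^+ 2.
  elim: n => [|n IH].
    rewrite expr0 mulr1 /M; have := E_ge0 0; rewrite /= /p /=; set e := \sum_i _; nra.
  have := F_contract (p n); rewrite -[F (p n)]/(p n.+1) [2^-1 ^+ n.+1]exprS => h.
  move: IH h; set e := E (p n); set e' := E (p n.+1).
  set z := 2^-1 ^+ n => h1 h2.
  have -> : (M * (2^-1 * z)) ^+ 2 = (M * z) ^+ 2 / 4 by field.
  rewrite ler_pdivlMr //; apply: le_trans h1.
  by rewrite mulrC.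
have b_ge0 n : 0 <= M * 2^-1 ^+ n by rewrite mulr_ge0 ?exprn_ge0 ?invr_ge0.
have p_geo n : `|p n.+1 - p n| <= M * 2^-1 ^+ n.
  apply: norm_sqr_le => //; apply: le_trans (E_p n); exact: F_dist.
have p_cvg := geometric_cvg p_geo.
exists (limn p) => i; apply/eqP; rewrite -subr_eq0 -normr_le0.
set q := limn p.
have b_cvg : (fun n => 2 * `|q - p n| + M * 2^-1 ^+ n) @ \oo --> (2 * 0 + 0 : R).
  apply: cvgD.
    apply: cvgM; first exact: cvg_cst.
    have : (fun n => q - p n) @ \oo --> q - q by apply: cvgB => //; apply: cvg_cst.
    by rewrite subrr => /cvg_norm; rewrite normr0.
  apply: cvg_geometric.
  by rewrite gtr0_norm ?invr_gt0 ?invf_lt1 ?ltr1n.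
rewrite mulr0 addr0 in b_cvg.
apply: (cvgr_to_ge b_cvg); near=> n.
have : `|T i (p n) - p n| <= M * 2^-1 ^+ n.
  apply: norm_sqr_le => //; apply: le_trans (E_p n).
  rewrite (bigD1 i) //= lerDl; apply: sumr_ge0 => k _; exact: ip_ge0.
(* Comparing with p_n, the displacement of the limit q is at most 2|q - p_n| + M / 2^n, which tends
   to 0. *)
have -> : T i q - q = (T i q - T i (p n)) + (T i (p n) - p n) + (p n - q).
  by rewrite !addrA !subrK.
move=> h; apply: le_trans (ler_normD _ _) _.
have := ler_normD (T i q - T i (p n)) (T i (p n) - p n).
rewrite T_isom (distrC (p n)); lra.
Unshelve. all: by end_near.
Qed.

End FixedPoint.

Section Midpoint.
Variables (R : realFieldType) (H : lmodType R) (dot : inner_product H).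
Hypothesis dot_def : forall x, dot x x = 0 -> x = 0.
Variables (A : finType) (inv : A -> A) (act1 : A -> H -> H).
Hypothesis invK : involutive inv.
Hypothesis act1K : forall a x, act1 (inv a) (act1 a x) = x.
Hypothesis act1_isom : forall a x y,
  dot (act1 a x - act1 a y) (act1 a x - act1 a y) = dot (x - y) (x - y).

(* If every word of length l.+1 fixes p then all letters send p to one and the
   same point q, and hence exchange p and q. *)
Lemma midpoint_fixed l p : (forall u : seq A, size u = l.+1 -> wact act1 u p = p) ->
  exists q, forall a, act1 a q = q.
Proof.
move=> fix_p; have [a0|noA] := pickP A; last by exists 0 => a; have := noA a.
have letter_p a : act1 a p = act1 a0 p.
  (* The word b a0^l has length l + 1 and fixes p, so b^-1 p = a0^l p for every letter b. *)
  have inv_p b : act1 (inv b) p = wact act1 (nseq l a0) p.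
    have fp : act1 b (wact act1 (nseq l a0) p) = p.
      by apply: (fix_p (b :: nseq l a0)); rewrite /= size_nseq.
    by rewrite -{1}fp act1K.
  by rewrite -(invK a) inv_p -(inv_p (inv a0)) invK.
pose q := act1 a0 p.
have letter_q a : act1 a q = p.
  by rewrite /q -(letter_p (inv a)) -{2}(act1K (inv a) p) invK.
(* The midpoint of p and q, fixed because letters act affinely. *)
exists (p + 2^-1 *: (q - p)) => a.
rewrite (isom_linpart dot_def (act1_isom a)) (linpartZ dot_def (act1_isom a)).
have lin_qp : linpart (act1 a) (q - p) = p - q.
  have := isom_linpart dot_def (act1_isom a) p (q - p).
  rewrite addrC subrK letter_q letter_p -/q => qp.
  by apply/eqP; rewrite eq_sym subr_eq addrC {1}qp.
rewrite letter_p -/q lin_qp -[p - q]opprB scalerN.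
rewrite -[X in X - _](subrK p q) -addrA addrC -addrA; congr (_ + _).
by rewrite -{2}[q - p]scale1r -scaleNr -scalerDl; congr (_ *: _); field.
Qed.

End Midpoint.

(** * Independent sampling *)

Section Average.
Variable R : realType.

(** Expectation for the uniform law; it is 0 on an empty [T], as inverting 0 gives 0. *)
Definition avg (T : finType) (f : T -> R) : R := (\sum_x f x) / #|T|%:R.

Lemma eq_avg (T : finType) (f g : T -> R) : f =1 g -> avg f = avg g.
Proof. by move=> fg; rewrite /avg (eq_bigr _ (fun x _ => fg x)). Qed.

Lemma avg_le (T : finType) (f g : T -> R) : (forall x, f x <= g x) -> avg f <= avg g.
Proof. by move=> fg; rewrite /avg ler_wpM2r ?invr_ge0 // ler_sum. Qed.

Lemma avg_ge0 (T : finType) (f : T -> R) : (forall x, 0 <= f x) -> 0 <= avg f.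
Proof. by move=> f0; rewrite /avg mulr_ge0 ?invr_ge0 ?sumr_ge0. Qed.

Lemma avg_sum (T : finType) I (r : seq I) (P : pred I) (f : I -> T -> R) :
  avg (fun x => \sum_(i <- r | P i) f i x) = \sum_(i <- r | P i) avg (f i).
Proof. by rewrite /avg exchange_big mulr_suml. Qed.

Lemma avgD (T : finType) (f g : T -> R) : avg (fun x => f x + g x) = avg f + avg g.
Proof. by rewrite /avg big_split mulrDl. Qed.

Lemma avgZ (T : finType) a (f : T -> R) : avg (fun x => a * f x) = a * avg f.
Proof. by rewrite /avg -mulr_sumr mulrA. Qed.

Lemma avg_cst (T : finType) a : (0 < #|T|)%N -> avg (fun _ : T => a) = a.
Proof.
by move=> T0; rewrite /avg sumr_const -[a *+ _]mulr_natr mulfK // pnatr_eq0 -lt0n.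
Qed.

Lemma avg_sqr_center (T : finType) (f : T -> R) :
  avg (fun x => (f x - avg f) ^+ 2) <= avg (fun x => f x ^+ 2).
Proof.
have [T0|T0] := posnP #|T|; first by rewrite /avg T0 invr0 !mulr0.
have -> : avg (fun x => (f x - avg f) ^+ 2)
  = avg (fun x => f x ^+ 2 + (- (2 * avg f) * f x + avg f ^+ 2)).
  by apply: eq_avg => x; ring.
by rewrite !avgD avgZ avg_cst //; have := sqr_ge0 (avg f); lra.
Qed.

Lemma avg_markov (T : finType) (f : T -> R) (t : R) (P : pred T) : 0 < t ->
  (forall x, 0 <= f x) -> (forall x, P x -> t <= f x) ->
  avg (fun x => (P x)%:R) <= avg f / t.
Proof.
move=> t0 f0 tf; rewrite mulrC -avgZ; apply: avg_le => x.
have [Px|_] := boolP (P x); last by rewrite mulr_ge0 ?invr_ge0 // ltW.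
by rewrite mulrC ler_pdivlMr // mul1r tf.
Qed.

End Average.

Section Resampling.
Variables (R : realType) (I Om : finType).
Local Notation sample := {ffun I -> Om}.

Definition resampled (F : sample) (i : I) (w : Om) : sample :=
  [ffun j => if j == i then w else F j].

(** Exchanging the fresh draw w with the old entry [F i] is an involution of the pairs (F, w), so
    redrawing one coordinate preserves the law. This is the form in which independence is used. *)
Lemma avg_resample i (G : sample -> R) :
  avg (fun F => avg (fun w => G (resampled F i w))) = avg G.
Proof.
have [Om0|Om0] := posnP #|Om|.
  have noF (F : sample) : False by have := fintype0 (F i) Om0.
  by rewrite /avg !big1 // => F; case: (noF F).
rewrite /avg -mulr_suml pair_bigA /=.
have -> : \sum_(p : sample * Om) G (resampled p.1 i p.2) =
          \sum_(p : sample * Om) G p.1.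
  pose h (p : sample * Om) := (resampled p.1 i p.2, p.1 i).
  have hK : involutive h.
    case=> F w; rewrite /h /= /resampled ffunE eqxx; congr (_, _).
    by apply/ffunP => j; rewrite !ffunE; case: eqP => // ->.
  by rewrite [RHS](reindex_inj (inv_inj hK)).
rewrite -(pair_bigA _ (fun F _ => G F)) /=.
under eq_bigr do rewrite sumr_const -mulr_natr.
by rewrite -mulr_suml mulfK // pnatr_eq0 -lt0n.
Qed.

Lemma avg_prod (J : pred I) (h : Om -> R) : (0 < #|Om|)%N ->
  avg (fun F : sample => \prod_(i | J i) h (F i)) = avg h ^+ #|J|.
Proof.
move=> Om0; pose G i w := if J i then h w else 1.
have -> : avg (fun F : sample => \prod_(i | J i) h (F i)) =
  (\sum_(F : sample) \prod_i G i (F i)) / #|Om|%:R ^+ #|I|.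
  by rewrite /avg card_ffun natrX; congr (_ / _); apply: eq_bigr => F _; rewrite big_mkcond.
have -> : #|Om|%:R ^+ #|I| = \prod_(i : I) #|Om|%:R :> R by rewrite prodr_const.
rewrite -(bigA_distr_bigA G) -prodf_div.
rewrite -prodr_const [RHS]big_mkcond; apply: eq_bigr => i _ /=.
rewrite /G unfold_in; case: (J i) => //.
by rewrite -[RHS](avg_cst 1 Om0).
Qed.

Definition hits (J : pred I) (S : pred Om) (F : sample) : nat :=
  #|[pred i | J i && S (F i)]|.

Lemma expR_hits (J : pred I) (S : pred Om) (s : R) F :
  expR (s * (hits J S F)%:R) = \prod_(i | J i) (if S (F i) then expR s else 1).
Proof.
rewrite mulrC expRM_natl /hits -prodr_const -big_mkcondr /=.
by apply: eq_bigl => i; rewrite unfold_in.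
Qed.

(** By independence the average is a power of 1 + (e^s - 1) p, with p the density of [S]; then 1 + u
    <= e^u. *)
Lemma avg_expR_hits (J : pred I) (S : pred Om) (s : R) : (0 < #|Om|)%N ->
  avg (fun F => expR (s * (hits J S F)%:R)) <=
  expR ((expR s - 1) * (#|S|%:R / #|Om|%:R) * #|J|%:R).
Proof.
move=> Om0; rewrite (eq_avg (expR_hits J S s)) (avg_prod J (fun w => if S w then expR s else 1)) //.
rewrite [leRHS]expRM_natr lerXn2r ?nnegrE ?expR_ge0 //.
  by apply: avg_ge0 => w; case: ifP => // _; apply: expR_ge0.
have -> : avg (fun w => if S w then expR s else 1) =
    1 + (expR s - 1) * (#|S|%:R / #|Om|%:R).
  have -> : avg (fun w => if S w then expR s else 1) =
     avg (fun w => 1 + (expR s - 1) * (S w)%:R).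
    by apply: eq_avg => w; case: (S w) => /=; ring.
  rewrite avgD avgZ avg_cst //; congr (_ + _ * (_ / _)).
  rewrite -natr_sum -sum1_card [in RHS]big_mkcond; congr (_%:R).
exact: expR_ge1Dx.
Qed.

(** Chernoff's method with exponent -1: mu/4 + (e^-1 - 1) mu <= -mu/4 since e >= 2. *)
Lemma hits_lower_tail (J : pred I) (S : pred Om) (mu : R) : (0 < #|Om|)%N ->
  mu = #|S|%:R / #|Om|%:R * #|J|%:R ->
  avg (fun F => ((hits J S F)%:R <= mu / 4 :> R)%:R) <= expR (- (mu / 4)).
Proof.
move=> Om0 muE.
have mu0 : 0 <= mu by rewrite muE !mulr_ge0 ?invr_ge0.
apply: (@le_trans _ _ (avg (fun F => expR (mu / 4) * expR (-1 * (hits J S F)%:R)))).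
  apply: avg_le => F; rewrite -expRD; case: (lerP _ (mu / 4)) => [h|_] /=; last by rewrite expR_ge0.
  by rewrite -[leLHS]expR0 ler_expR; lra.
rewrite avgZ; apply: le_trans (ler_wpM2l (expR_ge0 _) (avg_expR_hits J S (-1) Om0)) _.
rewrite -expRD ler_expR -mulrA -muE.
have : expR (-1) <= 2^-1 :> R.
  rewrite expRN lef_pV2 ?posrE ?expR_gt0 ?ltr0n //.
  by have := @expR_ge1Dx R 1; rewrite -natr1; lra.
nra.
Qed.

(** Chernoff's method with exponent 1: -4 mu + (e - 1) mu <= -mu since e <= 4. *)
Lemma hits_upper_tail (J : pred I) (S : pred Om) (rho : R) : (0 < #|Om|)%N ->
  #|S|%:R / #|Om|%:R <= rho ->
  avg (fun F => (4 * (rho * #|J|%:R) < (hits J S F)%:R :> R)%:R) <=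
    expR (- (rho * #|J|%:R)).
Proof.
move=> Om0 S_rho; set mu := rho * #|J|%:R.
apply: (@le_trans _ _ (avg (fun F => expR (- (4 * mu)) * expR (1 * (hits J S F)%:R)))).
  apply: avg_le => F; rewrite -expRD; case: (ltrP (4 * mu)) => [h|_] /=; last by rewrite expR_ge0.
  by rewrite -[leLHS]expR0 ler_expR; lra.
rewrite avgZ; apply: le_trans (ler_wpM2l (expR_ge0 _) (avg_expR_hits J S 1 Om0)) _.
rewrite -expRD ler_expR -mulrA.
have S_ge0 : 0 <= #|S|%:R / #|Om|%:R * #|J|%:R :> R by rewrite !mulr_ge0 ?invr_ge0.
have : #|S|%:R / #|Om|%:R * #|J|%:R <= mu by rewrite ler_wpM2r.
have : expR 1 <= 4 :> R.
  (* e <= 4 follows from e^(-1/2) >= 1 - 1/2. *)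
  have h : 2^-1 <= expR (- 2^-1) :> R by have := @expR_ge1Dx R (- 2^-1); lra.
  have -> : expR 1 = (expR (- 2^-1))^-1 ^+ 2 :> R.
    by rewrite -expRN opprK expr2 -expRD; congr expR; lra.
  have -> : 4 = 2 ^+ 2 :> R by ring.
  rewrite lerXn2r ?nnegrE ?invr_ge0 ?expR_ge0 //.
  by rewrite -[2 in leRHS]invrK lef_pV2 ?posrE ?expR_gt0 ?invr_gt0.
move: (_ * #|J|%:R) S_ge0 => x x0 h1 h2; nra.
Qed.

End Resampling.

(** * Products of independent centred random operators *)

Section RandomOperator.
Variables (R : realType) (Om V : finType) (Z : Om -> V -> V -> R) (sigma : R).
Hypothesis Om_gt0 : (0 < #|Om|)%N.
Hypothesis Z_mean : forall v x, avg (fun w => Z w v x) = 0.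
Hypothesis Z_var : forall b : V -> R,
  avg (fun w => \sum_v (\sum_x Z w v x * b x) ^+ 2) <= sigma * \sum_x b x ^+ 2.
Variables L k : nat.
Local Notation sample := {ffun 'I_L * 'I_k -> Om}.

Definition batch (F : sample) (i : 'I_L) (v x : V) : R := \sum_(j < k) Z (F (i, j)) v x.

(* The cross terms vanish because the entries of one batch are independent and centred. *)
Lemma avg_frobsq_batch i (C : sample -> V -> V -> R) :
  (forall F j w, C (resampled F (i, j) w) = C F) ->
  avg (fun F => frobsq (mulk (batch F i) (C F))) <=
  k%:R * sigma * avg (fun F => frobsq (C F)).
Proof.
move=> C_inv; pose z (F : sample) j v y := \sum_x Z (F (i, j)) v x * C F x y.
have -> : avg (fun F => frobsq (mulk (batch F i) (C F))) =
  \sum_j avg (fun F => \sum_v \sum_y z F j v y ^+ 2).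
  have zE F v y : mulk (batch F i) (C F) v y = \sum_j z F j v y.
    rewrite /mulk /batch /z; under eq_bigr do rewrite mulr_suml.
    by rewrite exchange_big.
  have -> : avg (fun F => frobsq (mulk (batch F i) (C F))) =
    \sum_j \sum_j' avg (fun F => \sum_v \sum_y z F j v y * z F j' v y).
    rewrite (@eq_avg _ _ _ (fun F => \sum_j \sum_j' \sum_v \sum_y z F j v y * z F j' v y)).
      by rewrite avg_sum; apply: eq_bigr => j _; rewrite avg_sum.
    move=> F; rewrite /frobsq.
    under eq_bigr => v _ do under eq_bigr => y _ do rewrite zE expr2 mulr_suml.
    under eq_bigr => v _ do rewrite exchange_big.
    rewrite exchange_big; apply: eq_bigr => j _ /=.
    under eq_bigr => v _ do under eq_bigr => y _ do rewrite mulr_sumr.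
    under eq_bigr => v _ do rewrite exchange_big.
    by rewrite exchange_big.
  apply: eq_bigr => j _; rewrite (bigD1 j) //= big1 ?addr0.
    by apply: eq_avg => F; apply: eq_bigr => v _; apply: eq_bigr => y _; rewrite expr2.
  move=> j' j'j; rewrite avg_sum big1 // => v _; rewrite avg_sum big1 // => y _.
  rewrite -(avg_resample (i, j)).
  have zj' F w : z (resampled F (i, j) w) j' v y = z F j' v y.
    by rewrite /z ffunE C_inv xpair_eqE eqxx (negPf j'j).
  have zj F w : z (resampled F (i, j) w) j v y = \sum_x C F x y * Z w v x.
    by rewrite /z ffunE C_inv eqxx; apply: eq_bigr => x _; rewrite mulrC.
  rewrite (@eq_avg _ _ _ (fun=> 0)); first by rewrite /avg big1 ?mul0r.
  move=> F; rewrite (@eq_avg _ _ _ (fun w => z F j' v y * \sum_x C F x y * Z w v x)).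
    rewrite avgZ avg_sum big1 ?mulr0 // => x _.
    by rewrite avgZ Z_mean mulr0.
  by move=> w; rewrite zj zj' mulrC.
apply: (@le_trans _ _ (\sum_(j < k) sigma * avg (fun F => frobsq (C F)))); last first.
  by rewrite sumr_const card_ord -[leLHS]mulr_natl mulrA.
apply: ler_sum => j _; rewrite -(avg_resample (i, j)) -avgZ; apply: avg_le => F.
rewrite (@eq_avg _ _ _ (fun w => \sum_y \sum_v (\sum_x Z w v x * C F x y) ^+ 2)).
  rewrite avg_sum /frobsq exchange_big mulr_sumr; apply: ler_sum => y _.
  exact: Z_var.
move=> w; rewrite exchange_big; apply: eq_bigr => y _; apply: eq_bigr => v _.
by rewrite /z ffunE C_inv eqxx.
Qed.

(** Provides the hypothesis [C_inv] of [avg_frobsq_batch] for products along distinct indices. *)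
Lemma prodk_batch_resampled F i j w u : i \notin u ->
  prodk (batch (resampled F (i, j) w)) u = prodk (batch F) u.
Proof.
elim: u => //= i' u IH; rewrite inE negb_or => /andP[ii' iu].
rewrite IH //; congr mulk; apply/funext => v; apply/funext => x.
by apply: eq_bigr => j' _; rewrite ffunE xpair_eqE eq_sym (negPf ii').
Qed.

(** Peel off one batch at a time: each contributes [k * sigma], as the remaining factors do not read
    it, and the identity has squared Frobenius norm #V. *)
Lemma avg_frobsq_prodk u : 0 <= sigma -> uniq u ->
  avg (fun F => frobsq (prodk (batch F) u)) <= (k%:R * sigma) ^+ size u * #|V|%:R.
Proof.
move=> sigma_ge0; elim: u => [|i u IH] /= => [_|/andP[iu uu]].
  rewrite expr0 mul1r; have -> : frobsq (@idk R V) = #|V|%:R.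
    rewrite /frobsq -sum1_card natr_sum; apply: eq_bigr => v _.
    rewrite (bigD1 v) //= /idk eqxx expr1n big1 ?addr0 // => x.
    by rewrite eq_sym => /negPf ->; rewrite expr0n.
  by rewrite avg_cst // card_ffun expn_gt0 Om_gt0.
apply: le_trans (avg_frobsq_batch _) _.
  by move=> F j w; apply: prodk_batch_resampled.
by rewrite exprS -[leRHS]mulrA ler_wpM2l ?mulr_ge0 ?IH.
Qed.

Lemma avg_frobsq_seqs n : 0 <= sigma ->
  avg (fun F => \sum_(u <- seqs L n | uniq u) frobsq (prodk (batch F) u)) <=
  L%:R ^+ n * (k%:R * sigma) ^+ n * #|V|%:R.
Proof.
move=> sigma_ge0; rewrite avg_sum.
have c_ge0 : 0 <= (k%:R * sigma) ^+ n * #|V|%:R.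
  by rewrite mulr_ge0 ?exprn_ge0 ?mulr_ge0.
apply: (@le_trans _ _ (\sum_(u <- seqs L n) (k%:R * sigma) ^+ n * #|V|%:R)).
  rewrite big_mkcond /= big_seq [leRHS]big_seq; apply: ler_sum => u us.
  case: ifP => // uu; rewrite -{1}(size_in_seqs us); exact: avg_frobsq_prodk.
by rewrite big_const_seq count_predT iter_addr_0 size_seqs -[leLHS]mulr_natl natrX mulrA.
Qed.

End RandomOperator.

(** * Spectral gap of random bipartite graphs *)

(** Union bound. *)
Lemma avg_exists_le (R : realType) (T J : finType) (P : J -> pred T) :
  avg (fun x => [exists j, P j x]%:R) <= \sum_j avg (fun x => (P j x)%:R : R).
Proof.
rewrite -avg_sum; apply: avg_le => x.
have [/existsP[j Pj]|_] := boolP [exists j, P j x]; last by rewrite sumr_ge0.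
by rewrite (bigD1 j) //= Pj lerDl sumr_ge0.
Qed.

Section BipartiteGap.
Variables (R : realType) (Om X Y : finType) (xm : Om -> X) (ym : Om -> Y).
Variable M : nat.
Hypothesis M_gt0 : (0 < M)%N.
Hypothesis Y_gt0 : (0 < #|Y|)%N.
Hypothesis YX : (#|Y| <= #|X|)%N.
Hypothesis fibers : forall a b, #|[pred w | (xm w == a) && (ym w == b)]| = M.

Local Notation nX := (#|X|%:R : R).
Local Notation nY := (#|Y|%:R : R).
Local Notation V := (X + Y)%type.

Let X_gt0 : (0 < #|X|)%N. Proof. exact: leq_trans YX. Qed.
Let nX_gt0 : 0 < nX. Proof. by rewrite ltr0n. Qed.
Let nY_gt0 : 0 < nY. Proof. by rewrite ltr0n. Qed.

Lemma sum_pair_map (G : X -> Y -> R) :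
  \sum_w G (xm w) (ym w) = M%:R * \sum_a \sum_b G a b.
Proof.
rewrite (partition_big (fun w => (xm w, ym w)) xpredT) //=.
rewrite pair_bigA mulr_sumr; apply: eq_bigr => -[a b] _ /=.
rewrite (eq_bigr (fun=> G a b)); last by move=> w /eqP[-> ->].
by rewrite sumr_const -[LHS]mulr_natl -(fibers a b).
Qed.

Lemma card_pair_map : #|Om|%:R = M%:R * (nX * nY).
Proof.
have := sum_pair_map (fun _ _ => 1).
rewrite sumr_const => ->; congr (_ * _).
by under eq_bigr do rewrite sumr_const; rewrite sumr_const -[LHS]mulr_natl.
Qed.

Lemma card_domain_gt0 : (0 < #|Om|)%N.
Proof. by rewrite -(ltr0n R) card_pair_map !mulr_gt0 // ltr0n. Qed.

Lemma avg_pair_map (G : X -> Y -> R) :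
  avg (fun w => G (xm w) (ym w)) = (\sum_a \sum_b G a b) / (nX * nY).
Proof.
rewrite /avg sum_pair_map card_pair_map; field.
by rewrite !lt0r_neq0 ?ltr0n.
Qed.

(** A draw [w] is an edge between [xm w] and [ym w], and [fibers] makes all edges equally likely.
    Working on the disjoint union X + Y makes the matrix symmetric, as [nsqf_opv_root] requires. *)
Definition adj (w : Om) (u v : V) : R :=
  match u, v with
  | inl a, inr b | inr b, inl a => ((xm w == a) && (ym w == b))%:R
  | _, _ => 0
  end.

Definition avg_adj (u v : V) : R :=
  match u, v with
  | inl _, inr _ | inr _, inl _ => (nX * nY)^-1
  | _, _ => 0
  end.

Definition centered_adj w u v := adj w u v - avg_adj u v.

Definition incident (u : V) (w : Om) :=
  match u with inl a => xm w == a | inr b => ym w == b end.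

Lemma adj_sym w u v : adj w u v = adj w v u.
Proof. by case: u v => [a|b] []. Qed.

Lemma avg_adj_sym u v : avg_adj u v = avg_adj v u.
Proof. by case: u v => [a|b] []. Qed.

Lemma adj_ge0 w u v : 0 <= adj w u v.
Proof. by case: u v => [a|b] [] /=. Qed.

Lemma avg_adj_ge0 u v : 0 <= avg_adj u v.
Proof. by case: u v => [a|b] [] //= _; rewrite invr_ge0 mulr_ge0. Qed.

Lemma sum_adj_mul w u (f : V -> R) : \sum_v adj w u v * f v =
  match u with
  | inl a => (xm w == a)%:R * f (inr (ym w))
  | inr b => (ym w == b)%:R * f (inl (xm w))
  end.
Proof.
case: u => [a|b]; rewrite big_sumType /=.
  rewrite big1 ?add0r => [|a' _]; last by rewrite mul0r.
  rewrite (bigD1 (ym w)) //= eqxx andbT big1 ?addr0 // => b.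
  by rewrite eq_sym => /negPf ->; rewrite andbF mul0r.
rewrite [X in _ + X]big1 ?addr0 => [|b' _]; last by rewrite mul0r.
rewrite (bigD1 (xm w)) //= eqxx big1 ?addr0 // => a.
by rewrite eq_sym => /negPf ->; rewrite mul0r.
Qed.

Lemma sum_adj w u : \sum_v adj w u v = (incident u w)%:R.
Proof.
have := sum_adj_mul w u (fun=> 1); under eq_bigr do rewrite mulr1.
by move=> ->; case: u => ? /=; rewrite mulr1.
Qed.

Lemma sum_avg_adj_le u : \sum_v avg_adj u v <= nY^-1.
Proof.
case: u => [a|b]; rewrite big_sumType /= !sumr_const mul0rn ?add0r ?addr0.
  by rewrite -[leLHS]mulr_natr invfM mulfVK ?lt0r_neq0 // lef_pV2 ?posrE // ler_nat.
by rewrite -[leLHS]mulr_natr invfM mulrAC mulVf ?mul1r ?lt0r_neq0.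
Qed.

Lemma avg_adjE u v : avg (fun w => adj w u v) = avg_adj u v.
Proof.
have avg1 a b : avg (fun w => ((xm w == a) && (ym w == b))%:R) = (nX * nY)^-1 :> R.
  rewrite (avg_pair_map (fun a' b' => ((a' == a) && (b' == b))%:R)).
  rewrite (bigD1 a) //= (bigD1 b) //= !eqxx !big1 ?addr0 ?mul1r //.
    by move=> a' /negPf ->; rewrite big1.
  by move=> b' /negPf ->; rewrite andbF.
by case: u v => [a|b] [a'|b'] //=; rewrite /avg big1 ?mul0r.
Qed.

Lemma centered_adj_mean u v : avg (fun w => centered_adj w u v) = 0.
Proof.
have -> : avg (fun w => centered_adj w u v) =
    avg (fun w => adj w u v + (-1) * avg_adj u v).
  by apply: eq_avg => w; rewrite /centered_adj mulN1r.
by rewrite avgD avgZ (avg_cst _ card_domain_gt0) avg_adjE mulN1r subrr.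
Qed.

(** Centring only lowers second moments. A single edge exchanges the values of f at its two ends, so
    the second moment is the mean of f^2 over X plus its mean over Y, and #Y <= #X. *)
Lemma centered_adj_var (f : V -> R) :
  avg (fun w => \sum_u (\sum_v centered_adj w u v * f v) ^+ 2) <=
  nY^-1 * \sum_v f v ^+ 2.
Proof.
pose s w u := \sum_v adj w u v * f v.
have sE w u : \sum_v centered_adj w u v * f v = s w u - avg (s^~ u).
  rewrite /s avg_sum -sumrB; apply: eq_bigr => v _.
  rewrite mulrBl; congr (_ - _); rewrite -avg_adjE mulrC -avgZ.
  by apply: eq_avg => w'; rewrite mulrC.
apply: (@le_trans _ _ (avg (fun w => \sum_u s w u ^+ 2))).
  rewrite !avg_sum; apply: ler_sum => u _.
  under eq_avg => w do rewrite sE.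
  exact: avg_sqr_center.
have -> : avg (fun w => \sum_u s w u ^+ 2) =
    avg (fun w => f (inr (ym w)) ^+ 2 + f (inl (xm w)) ^+ 2).
  apply: eq_avg => w; rewrite big_sumType /=; congr (_ + _).
    rewrite (bigD1 (xm w)) //= /s sum_adj_mul eqxx mul1r big1 ?addr0 // => a.
    by rewrite sum_adj_mul eq_sym => /negPf ->; rewrite mul0r expr0n.
  rewrite (bigD1 (ym w)) //= /s sum_adj_mul eqxx mul1r big1 ?addr0 // => b.
  by rewrite sum_adj_mul eq_sym => /negPf ->; rewrite mul0r expr0n.
rewrite (avg_pair_map (fun a b => f (inr b) ^+ 2 + f (inl a) ^+ 2)).
rewrite (eq_bigr (fun a => \sum_b f (inr b) ^+ 2 + nY * f (inl a) ^+ 2)); last first.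
  by move=> a _; rewrite big_split /= sumr_const -[_ *+ #|Y|]mulr_natl.
rewrite big_split /= sumr_const -[_ *+ #|X|]mulr_natl -mulr_sumr big_sumType /=.
set SX := \sum_a f (inl a) ^+ 2; set SY := \sum_b f (inr b) ^+ 2.
have SX_ge0 : 0 <= SX by apply: sumr_ge0 => a _; apply: sqr_ge0.
have -> : (nX * SY + nY * SX) / (nX * nY) = nX^-1 * SX + nY^-1 * SY.
  by field; rewrite !lt0r_neq0.
by rewrite mulrDr lerD2r ler_wpM2r // lef_pV2 ?posrE // ler_nat.
Qed.

Variables (L k n : nat) (tau : R).
Hypothesis L_gt0 : (0 < L)%N.
Hypothesis k_gt0 : (0 < k)%N.
Hypothesis tau_gt0 : 0 < tau.
Local Notation sample := {ffun 'I_L * 'I_k -> Om}.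
Local Notation kappa := (k%:R / nY).

Let kappa_gt0 : 0 < kappa. Proof. by rewrite divr_gt0 ?ltr0n. Qed.

Definition in_batch (i : 'I_L) : pred ('I_L * 'I_k) := [pred p | p.1 == i].

Lemma card_in_batch i : #|in_batch i| = k.
Proof.
rewrite -[RHS]card_ord -sum1_card -[RHS]sum1_card.
rewrite (reindex_onto (fun j : 'I_k => (i, j)) snd) /=; last first.
  by case=> i' j /eqP /= ->.
by apply: eq_bigl => j; rewrite inE /= !eqxx.
Qed.

Definition frob_total (F : sample) :=
  \sum_(u <- seqs L n | uniq u) frobsq (prodk (batch centered_adj F) u).

(** Half of L^n (tau kappa^2)^n, the total allowed besides the Cauchy-Schwarz factor L^n; [L_large]
    fits the products with a repeated index into the other half. *)
Definition frob_bound : R := L%:R ^+ n * (tau * kappa ^+ 2) ^+ n / 2.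

(** Everything the gap asks of randomness, with no mention of [H]: small Frobenius norms, and
    degrees at most 4 [kappa] within each batch. *)
Definition gap_sample (F : sample) : bool :=
  (frob_total F < frob_bound) &&
  [forall p : 'I_L * V, (hits (in_batch p.1) (incident p.2) F)%:R
     <= 4 * (nY^-1 * #|in_batch p.1|%:R)].

Let frob_bound_gt0 : 0 < frob_bound.
Proof. by rewrite !(mulr_gt0, exprn_gt0) ?ltr0n ?invr_gt0 ?ltr0n // !(mulr_gt0, exprn_gt0) ?invr_gt0. Qed.

(** Markov's inequality handles the Frobenius total, whose mean is at most (L kappa)^n times the
    number of vertices; Chernoff and a union bound over batches and vertices handle the degrees. *)
Lemma gap_sample_prob :
  avg (fun F : sample => (~~ gap_sample F)%:R) <=
  2 * (nX + nY) / (tau * kappa) ^+ n + L%:R * (nX + nY) * expR (- kappa).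
Proof.
pose P1 F := frob_bound <= frob_total F.
pose P2 (p : 'I_L * V) (F : sample) := 4 * (nY^-1 * #|in_batch p.1|%:R) <
    (hits (in_batch p.1) (incident p.2) F)%:R.
apply: (@le_trans _ _ (avg (fun F => (P1 F)%:R + [exists p, P2 p F]%:R))).
  apply: avg_le => F; rewrite /gap_sample negb_and -leNgt negb_forall.
  rewrite (@eq_existsb _ _ (P2^~ F)); last by move=> p; rewrite -ltNge.
  by rewrite -/(P1 F); case: (P1 F) => /=; rewrite ?lerDl ?add0r.
have cV : #|{: V}|%:R = nX + nY by rewrite card_sum natrD.
rewrite avgD lerD //.
  apply: (@le_trans _ _ (avg frob_total / frob_bound)).
    apply: avg_markov => // F; rewrite /frob_total.
    by apply: sumr_ge0 => u _; apply: frobsq_ge0.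
  have := avg_frobsq_seqs card_domain_gt0 centered_adj_mean centered_adj_var L k n.
  rewrite invr_ge0 ler0n => /(_ isT); rewrite cV => h.
  rewrite ler_pdivrMr //; apply: le_trans h _.
  rewrite /frob_bound le_eqVlt; apply/orP; left; apply/eqP.
  rewrite !exprMn; field; rewrite !expf_neq0 ?lt0r_neq0 ?invr_gt0 ?ltr0n //.
apply: le_trans (avg_exists_le R P2) _.
apply: (@le_trans _ _ (\sum_(p : 'I_L * V) expR (- kappa))).
  apply: ler_sum => -[i u] _ /=.
  have /= := @hits_upper_tail R _ Om (in_batch i) (incident u) nY^-1 card_domain_gt0.
  rewrite /P2 /= card_in_batch [nY^-1 * _]mulrC; apply.
  have -> : #|incident u|%:R / #|Om|%:R = avg (fun w => (incident u w)%:R) :> R.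
    congr (_ / _); rewrite -sum1_card natr_sum big_mkcond /=.
    by apply: eq_bigr => w _; rewrite -[w \in _]/(incident u w); case: (incident u w).
  apply: le_trans (sum_avg_adj_le u).
  rewrite -(eq_bigr _ (fun v _ => avg_adjE u v)) -avg_sum.
  by apply: avg_le => w; rewrite sum_adj.
by rewrite sumr_const card_prod card_ord -[leLHS]mulr_natl natrM cV.
Qed.

Hypothesis L_large : 2 * n%:R ^+ 2 * 34 ^+ n <= tau ^+ n * L%:R.
Hypothesis n_pow2 : exists s, n = (2 ^ s)%N.

Variables (H : lmodType R) (dot : inner_product H).

(** Schur's test bounds the adjacency part by (4 kappa)^2 and the mean part by kappa^2, whence 34 =
    2 * 16 + 2. *)
Lemma gap_sample_batch F i (g : V -> H) : gap_sample F ->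
  nsqf dot (opv (batch centered_adj F i) g) <= (34 * kappa ^+ 2) * nsqf dot g.
Proof.
case/andP=> _ /forallP deg.
pose A1 u v := \sum_(j < k) adj (F (i, j)) u v.
pose A2 u v := k%:R * avg_adj u v.
have A1_deg u : \sum_v A1 u v <= 4 * kappa.
  have := deg (i, u); rewrite /= card_in_batch mulrC [nY^-1 * _]mulrC mulrC.
  congr (_ <= _); rewrite /A1 exchange_big /=.
  under [RHS]eq_bigr => j _ do rewrite sum_adj.
  rewrite /hits -sum1_card natr_sum.
  rewrite (reindex_onto (fun j : 'I_k => (i, j)) snd) /=; last first.
    by case=> i' j /andP[/eqP /= ->].
  rewrite big_mkcond /=; apply: eq_bigr => j _.
  by rewrite inE /= /in_batch /= !eqxx /= andbT; case: incident.
have A2_deg u : \sum_v A2 u v <= kappa.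
  by rewrite -mulr_sumr ler_wpM2l ?sum_avg_adj_le.
have h1 := @nsqf_opv_schur R V H dot A1 _ g _ _ A1_deg.
have h2 := @nsqf_opv_schur R V H dot A2 _ g _ _ A2_deg.
have : nsqf dot (opv (batch centered_adj F i) g) <=
    2 * nsqf dot (opv A1 g) + 2 * nsqf dot (opv A2 g).
  rewrite /nsqf !mulr_sumr -big_split; apply: ler_sum => u _ /=.
  have -> : opv (batch centered_adj F i) g u = opv A1 g u + - opv A2 g u.
    rewrite /opv -sumrN -big_split; apply: eq_bigr => v _ /=.
    rewrite -scaleNr -scalerDl; congr (_ *: _).
    by rewrite /batch /centered_adj sumrB sumr_const card_ord -[_ *+ k]mulr_natl.
  by apply: le_trans (nsqD_le _ _ _) _; rewrite nsqN.
move/le_trans; apply.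
have {h1} : nsqf dot (opv A1 g) <= (4 * kappa) ^+ 2 * nsqf dot g.
  apply: h1 => u v; first by apply: sumr_ge0 => j _; apply: adj_ge0.
  by apply: eq_bigr => j _; apply: adj_sym.
have {h2} : nsqf dot (opv A2 g) <= kappa ^+ 2 * nsqf dot g.
  apply: h2 => u v; first by rewrite mulr_ge0 ?avg_adj_ge0.
  by rewrite /A2 avg_adj_sym.
rewrite exprMn; set x := nsqf dot g; set y := kappa ^+ 2; lra.
Qed.

(** Extend [g] by 0 on X. As [g] sums to 0, the constant mean part kills it on X, so there the
    centred operator sums [g] over neighbours; a bound on its n-th power gives the gap. *)
Lemma bipartite_gap F (g : Y -> H) : gap_sample F -> \sum_b g b = 0 ->
  \sum_a dot (\sum_(p | xm (F p) == a) g (ym (F p)))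
             (\sum_(p | xm (F p) == a) g (ym (F p)))
  <= tau * kappa ^+ 2 * L%:R ^+ 2 * \sum_b dot (g b) (g b).
Proof.
move=> Fgap g0.
pose A u v := \sum_(i < L) batch centered_adj F i u v.
pose lam := tau * kappa ^+ 2 * L%:R ^+ 2.
have lam_gt0 : 0 < lam by rewrite !mulr_gt0 ?exprn_gt0 ?invr_gt0 ?ltr0n.
pose gV (v : V) : H := if v is inr b then g b else 0.
have gVE : nsqf dot gV = \sum_b dot (g b) (g b).
  by rewrite /nsqf big_sumType /= big1 ?add0r // => a _; rewrite ip0l.
suff h : nsqf dot (opv A gV) <= lam * nsqf dot gV.
  rewrite -gVE; apply: le_trans h; rewrite /nsqf big_sumType /=.
  rewrite -[leLHS]addr0 lerD //; last by apply: sumr_ge0 => b _; apply: ip_ge0.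
  apply: ler_sum => a _.
  have -> // : opv A gV (inl a) = \sum_(p | xm (F p) == a) g (ym (F p)).
  rewrite /opv big_sumType /= big1 ?add0r => [|a' _]; last by rewrite scaler0.
  have AE b : A (inl a) (inr b) =
     \sum_(p | xm (F p) == a) (ym (F p) == b)%:R - (L * k)%:R / (nX * nY).
    rewrite /A /batch pair_bigA /= /centered_adj sumrB; congr (_ - _).
      rewrite [RHS]big_mkcond; apply: eq_bigr => -[i j] _ /=.
      by case: eqP.
    rewrite /= sumr_const [RHS]mulr_natl; congr (_ *+ _).
    by rewrite -[LHS]/(#|{: 'I_L * 'I_k}|) card_prod !card_ord.
  under eq_bigr => b _ do rewrite AE scalerBl.
  rewrite sumrB -scaler_sumr g0 scaler0 subr0.
  transitivity (\sum_b \sum_(p | xm (F p) == a) (ym (F p) == b)%:R *: g b).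
    by apply: eq_bigr => b _; rewrite scaler_suml.
  rewrite exchange_big /=; apply: eq_bigr => p _.
  rewrite (bigD1 (ym (F p))) //= eqxx scale1r big1 ?addr0 // => b.
  by rewrite eq_sym => /negPf ->; rewrite scale0r.
have [s ns] := n_pow2.
apply: (nsqf_opv_root (s := s)) => // [u v|{}g {g0 gV gVE}].
  apply: eq_bigr => i _; apply: eq_bigr => j _.
  by rewrite /centered_adj adj_sym avg_adj_sym.
rewrite -ns; apply: le_trans (nsqf_iter_le _ _ L_gt0 _ (fun i g => gap_sample_batch i g Fgap)) _.
  by rewrite mulr_ge0 ?exprn_ge0 ?ltW.
rewrite ler_wpM2r ?nsqf_ge0 //.
case/andP: Fgap => /ltW Phi_le _.
have -> : lam ^+ n = L%:R ^+ n * (frob_bound + frob_bound).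
  rewrite /frob_bound -splitr /lam -exprMn -[RHS]exprMn; congr (_ ^+ _); ring.
rewrite ler_wpM2l ?exprn_ge0 // lerD //.
rewrite /frob_bound [(34 * _) ^+ n]exprMn [(tau * _) ^+ n]exprMn.
have L0 : (0 : R) < L%:R by rewrite ltr0n.
have kn : 0 <= L%:R ^+ n * (kappa ^+ 2) ^+ n.
  by rewrite mulr_ge0 ?exprn_ge0 ?ltW.
have : n%:R ^+ 2 * 34 ^+ n / L%:R <= tau ^+ n / 2.
  by rewrite ler_pdivrMr // [leRHS]mulrAC ler_pdivlMr // mulrC mulrA.
move/(ler_wpM2r kn); set z := L%:R ^+ n; set y := (kappa ^+ 2) ^+ n.
by congr (_ <= _); ring.
Qed.

End BipartiteGap.

(** * Relators cut into three pieces *)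

(** The three maps identify [Om] with the product of X, Y and Z, so the fibre over a pair is a copy
    of Z. *)
Lemma card_fiber (Om X Y Z : finType) (xm : Om -> X) (ym : Om -> Y) (zm : Om -> Z)
    (j : X -> Y -> Z -> Om) :
  (forall w, j (xm w) (ym w) (zm w) = w) ->
  (forall x y z, [/\ xm (j x y z) = x, ym (j x y z) = y & zm (j x y z) = z]) ->
  forall x y, #|[pred w | (xm w == x) && (ym w == y)]| = #|Z|.
Proof.
move=> jK Kj x y.
have j_inj : injective (j x y).
  by move=> z z' e; have [_ _ <-] := Kj x y z; rewrite e; have [_ _] := Kj x y z'.
rewrite -(card_codom j_inj); apply: eq_card => w; rewrite inE.
apply/andP/codomP => [[/eqP <- /eqP <-]|[z ->]]; first by exists (zm w); rewrite jK.
by have [-> -> _] := Kj x y z; rewrite !eqxx.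
Qed.

Section WordRelators.
Variables (A : finType) (inv : A -> A) (a0 : A).
Hypothesis invK : involutive inv.
Variables (l t eta : nat).
Local Notation l' := (l + t.*2)%N.
Hypothesis eta_eq : eta = (l + (l' + l))%N.
Local Notation Y := (l.-tuple A).
Local Notation X := (l'.-tuple A).
Local Notation Om := (eta.-tuple A).

Lemma size_piece i n (w : Om) : (i + n <= eta)%N -> size (take n (drop i w)) == n.
Proof.
by move=> le_in; rewrite size_takel // size_drop size_tuple leq_subRL // (leq_trans _ le_in) ?leq_addr.
Qed.

Lemma first_piece_subproof (w : Om) : size (take l (drop 0 w)) == l.
Proof. by apply: size_piece; rewrite eta_eq leq_addr. Qed.
Lemma middle_piece_subproof (w : Om) : size (take l' (drop l w)) == l'.
Proof. by apply: size_piece; rewrite eta_eq leq_add2l leq_addr. Qed.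
Lemma last_piece_subproof (w : Om) : size (take l (drop (l + l') w)) == l.
Proof. by apply: size_piece; rewrite eta_eq [leqRHS]addnA. Qed.
Lemma twinv_subproof (y : Y) : size (winv inv y) == l.
Proof. by rewrite size_winv size_tuple. Qed.
Lemma join_pieces_subproof (a : Y) (b : X) (c : Y) : size (a ++ b ++ c) == eta.
Proof. by rewrite !size_cat !size_tuple eta_eq. Qed.

Definition first_piece (w : Om) : Y := Tuple (first_piece_subproof w).
Definition middle_piece (w : Om) : X := Tuple (middle_piece_subproof w).
Definition last_piece (w : Om) : Y := Tuple (last_piece_subproof w).
Definition twinv (y : Y) : Y := Tuple (twinv_subproof y).
Definition join_pieces (a : Y) (b : X) (c : Y) : Om := Tuple (join_pieces_subproof a b c).
Definition first_piece_inv (w : Om) : Y := twinv (first_piece w).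

Lemma twinvK : involutive twinv.
Proof. by move=> y; apply: val_inj; apply: winvK. Qed.

Lemma join_piecesK w : join_pieces (first_piece w) (middle_piece w) (last_piece w) = w.
Proof.
apply: val_inj => /=; rewrite drop0.
rewrite [take l (drop _ _)]take_oversize; last first.
  by rewrite size_drop size_tuple eta_eq addnA addKn.
rewrite [(l + l')%N]addnC -drop_drop.
by rewrite !cat_take_drop.
Qed.

Lemma first_join a b c : first_piece (join_pieces a b c) = a.
Proof. by apply: val_inj; rewrite /= drop0 take_size_cat ?size_tuple. Qed.

Lemma middle_join a b c : middle_piece (join_pieces a b c) = b.
Proof.
by apply: val_inj; rewrite /= drop_size_cat ?size_tuple // take_size_cat ?size_tuple.
Qed.

Lemma last_join a b c : last_piece (join_pieces a b c) = c.
Proof.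
apply: val_inj; rewrite /= addnC -drop_drop drop_size_cat ?size_tuple //.
by rewrite drop_size_cat ?size_tuple // take_oversize ?size_tuple.
Qed.

Lemma fibers_last b c :
  #|[pred w | (middle_piece w == b) && (last_piece w == c)]| = #|{: Y}|.
Proof.
apply: (card_fiber (zm := first_piece) (j := fun b c a => join_pieces a b c)).
  exact: join_piecesK.
by move=> *; rewrite middle_join last_join first_join.
Qed.

Lemma fibers_first_inv b c :
  #|[pred w | (middle_piece w == b) && (first_piece_inv w == c)]| = #|{: Y}|.
Proof.
apply: (card_fiber (zm := last_piece) (j := fun b a c => join_pieces (twinv a) b c)).
  by move=> w; rewrite /first_piece_inv twinvK join_piecesK.
by move=> *; rewrite /first_piece_inv middle_join last_join first_join twinvK.
Qed.

Definition padding := flatten (nseq t [:: a0; inv a0]).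

Lemma size_padding : size padding = t.*2.
Proof. by rewrite /padding; elim: t => //= n ->. Qed.

Lemma pad_subproof (y : Y) : size (y ++ padding) == l'.
Proof. by rewrite size_cat size_tuple size_padding. Qed.

Definition pad (y : Y) : X := Tuple (pad_subproof y).

Lemma pad_inj : injective pad.
Proof.
move=> y z /(congr1 val) /= e; apply: val_inj.
have := congr1 (take l) e; by rewrite !take_size_cat ?size_tuple.
Qed.

Variable R : realType.
Variables (L k n : nat).
Local Notation sample := {ffun 'I_L * 'I_k -> Om}.
Local Notation q := (#|A|%:R ^+ t.*2 : R).
Local Notation nX := (#|{: X}|%:R : R).
Local Notation nY := (#|{: Y}|%:R : R).
Local Notation kappa := (k%:R / nY).
(** The value for which 16 tau kappa^2 L^2 is the square of a quarter of the mean degree L kappa /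
    q, as [energy_contract] asks. It is independent of [l]. *)
Definition gap_const : R := (256 * q ^+ 2)^-1.
Local Notation tau := gap_const.

Definition mean_degree : R := (L * k)%:R / nX.

Definition good_sample (F : sample) : bool :=
  [&& gap_sample middle_piece last_piece n tau F,
      gap_sample middle_piece first_piece_inv n tau F &
      [forall b, mean_degree / 4 < (hits xpredT [pred w | middle_piece w == b] F)%:R]].

Hypothesis L_gt0 : (0 < L)%N.
Hypothesis k_gt0 : (0 < k)%N.

Let A_gt0 : (0 < #|A|)%N. Proof. by apply/card_gt0P; exists a0. Qed.
Let Y_gt0 : (0 < #|{: Y}|)%N. Proof. by rewrite card_tuple expn_gt0 A_gt0. Qed.
Let YX : (#|{: Y}| <= #|{: X}|)%N.
Proof. by rewrite !card_tuple leq_pexp2l // leq_addr. Qed.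
Let Om_gt0 : (0 < #|{: Om}|)%N. Proof. by rewrite card_tuple expn_gt0 A_gt0. Qed.
Let q_gt0 : 0 < q. Proof. by rewrite exprn_gt0 ?ltr0n. Qed.
Let tau_gt0 : 0 < tau. Proof. by rewrite invr_gt0 mulr_gt0 ?exprn_gt0 ?ltr0n. Qed.
Let nXE : nX = nY * q. Proof. by rewrite !card_tuple expnD natrM !natrX. Qed.
Let nY_gt0 : 0 < nY. Proof. by rewrite ltr0n. Qed.

Lemma good_sample_prob :
  avg (fun F : sample => (~~ good_sample F)%:R) <=
  2 * (2 * (nX + nY) / (tau * kappa) ^+ n + L%:R * (nX + nY) * expR (- kappa))
  + nX * expR (- (mean_degree / 4)).
Proof.
pose P1 (F : sample) : bool := ~~ gap_sample middle_piece last_piece n tau F.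
pose P2 (F : sample) : bool := ~~ gap_sample middle_piece first_piece_inv n tau F.
pose P3 b (F : sample) : bool := (hits xpredT [pred w | middle_piece w == b] F)%:R <= mean_degree / 4.
apply: (@le_trans _ _ (avg (fun F : sample => (P1 F)%:R + (P2 F)%:R + [exists b, P3 b F]%:R))).
  apply: avg_le => F; rewrite /good_sample /P1 /P2.
  move: (gap_sample _ last_piece _ _ _) (gap_sample _ first_piece_inv _ _ _) => b1 b2.
  rewrite !negb_and negb_forall (@eq_existsb _ _ (P3^~ F)); last by move=> b; rewrite -leNgt.
  by case: b1; case: b2; case: [exists b, P3 b F] => /=; lra.
rewrite !avgD; set B := (X in 2 * X + _).
have -> : 2 * B = B + B by ring.
apply: lerD; first apply: lerD.
- by have := @gap_sample_prob R _ _ _ _ _ _ Y_gt0 Y_gt0 YX fibers_last L k n _ L_gt0 k_gt0 tau_gt0; apply.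
- by have := @gap_sample_prob R _ _ _ _ _ _ Y_gt0 Y_gt0 YX fibers_first_inv L k n _ L_gt0 k_gt0 tau_gt0; apply.
apply: le_trans (avg_exists_le R P3) _.
apply: (@le_trans _ _ (\sum_(b : X) expR (- (mean_degree / 4)))); last first.
  by rewrite sumr_const -[leLHS]mulr_natl.
apply: ler_sum => b _; apply: (hits_lower_tail (mu := mean_degree)) => //.
have -> : #|(xpredT : pred ('I_L * 'I_k))| = (L * k)%N.
  by rewrite -[LHS]/(#|{: 'I_L * 'I_k}|) card_prod !card_ord.
rewrite /mean_degree mulrC; congr (_ * _).
have -> : #|[pred w | middle_piece w == b]|%:R / #|{: Om}|%:R =
  avg (fun w => (middle_piece w == b)%:R) :> R.
  congr (_ / _); rewrite -sum1_card natr_sum big_mkcond /=.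
  by apply: eq_bigr => w _; rewrite inE; case: eqP.
have := @avg_pair_map R _ _ _ _ _ _ Y_gt0 Y_gt0 YX fibers_last (fun b' _ => (b' == b)%:R).
move=> ->; rewrite (bigD1 b) //= eqxx [X in _ + X]big1 ?addr0; last first.
  by move=> b' /negPf b'b; rewrite big1 // => ? _; rewrite b'b.
rewrite sumr_const -[_ *+ _]mulr_natl mulr1 invfM mulrC mulfVK //.
by rewrite lt0r_neq0.
Qed.

Hypothesis l_gt0 : (0 < l)%N.
Hypothesis L_large : 2 * n%:R ^+ 2 * 34 ^+ n <= tau ^+ n * L%:R.
Hypothesis n_pow2 : exists s, n = (2 ^ s)%N.
Variables (H : completeNormedModType R) (dot : inner_product H).
Hypothesis dot_norm : forall x, dot x x = `|x| ^+ 2.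
Variable act1 : A -> H -> H.
Hypothesis act1K : forall a x, act1 (inv a) (act1 a x) = x.
Hypothesis act1_isom : forall a x y, `|act1 a x - act1 a y| = `|x - y|.

Lemma good_sample_fixpoint (F : sample) : good_sample F ->
  (forall p x, wact act1 (F p) x = x) -> exists x, forall a, act1 a x = x.
Proof.
case/and3P => gap_c gap_a /forallP deg relator.
have dot_def x : dot x x = 0 -> x = 0.
  by rewrite dot_norm => /eqP; rewrite sqrf_eq0 normr_eq0 => /eqP.
have isom a x y : dot (act1 a x - act1 a y) (act1 a x - act1 a y) = dot (x - y) (x - y).
  by rewrite !dot_norm act1_isom.
have wisom u x y : `|wact act1 u x - wact act1 u y| = `|x - y|.
  by elim: u => //= a u IH; rewrite act1_isom.
have relator3 p x : wact act1 (first_piece (F p)) (wact act1 (middle_piece (F p))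
    (wact act1 (last_piece (F p)) x)) = x.
  have e : first_piece (F p) ++ middle_piece (F p) ++ last_piece (F p) = F p :> seq A.
    exact: (congr1 val (join_piecesK (F p))).
  by rewrite -!wact_cat -[(_ ++ _) ++ _]catA e relator.
have pad_act (y : Y) x : wact act1 (pad y) x = wact act1 y x.
  rewrite wact_cat; congr (wact act1 _ _).
  rewrite /padding; elim: (t) => //= i ->.
  by rewrite -{1}[a0]invK act1K.
have mean_gt0 : 0 < mean_degree / 4.
  by rewrite !divr_gt0 // ltr0n ?muln_gt0 ?L_gt0 // (leq_trans Y_gt0).
have deg' b : mean_degree / 4 <= #|[pred p | middle_piece (F p) == b]|%:R.
  exact: ltW (deg b).
have Lam_le : 16 * (tau * kappa ^+ 2 * L%:R ^+ 2) <= (mean_degree / 4) ^+ 2.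
  rewrite /mean_degree nXE /gap_const natrM le_eqVlt; apply/orP; left; apply/eqP.
  by field; rewrite !lt0r_neq0.
have [x fix_x] : exists x, forall y : Y, wact act1 y x = x.
  apply: (contraction_fixpoint dot_norm (F := orbit_mean act1 l)) => [y u v|x|x].
  - exact: wisom.
  - apply: (energy_contract dot_def act1K isom Y_gt0 relator3
      (ainv := first_piece_inv \o F) _ pad_inj pad_act mean_gt0 deg' Lam_le) => //.
    + by move=> g; apply: (bipartite_gap Y_gt0 YX L_gt0 k_gt0 tau_gt0 L_large n_pow2 dot gap_c).
    + by move=> g; apply: (bipartite_gap Y_gt0 YX L_gt0 k_gt0 tau_gt0 L_large n_pow2 dot gap_a).
  - exact: orbit_mean_dist.
(* [midpoint_fixed] speaks of length [l.+1], hence the predecessor of the positive [l]. *)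
apply: (midpoint_fixed dot_def invK act1K isom (l := l.-1) (p := x)) => u su.
have su' : size u == l by rewrite su prednK.
exact: (fix_x (Tuple su')).
Qed.

End WordRelators.

(** * From independent samples to uniform subsets *)

Section UniformSubsets.
Variables (R : realType) (Om I : finType).
Implicit Types (P Q : {set Om}) (sigma : {perm Om}).

(** Lists all of [Om] with the elements of [P] first; matching two such lists by position yields a
    permutation carrying one set onto another of the same size. *)
Definition split_enum P := enum P ++ enum (~: P).

Lemma split_enum_uniq P : uniq (split_enum P).
Proof.
rewrite cat_uniq !enum_uniq andbT /=; apply/hasPn => x.
by rewrite !mem_enum finset.in_setC.
Qed.

Lemma mem_split_enum P x : x \in split_enum P.
Proof. by rewrite mem_cat !mem_enum finset.in_setC orbN. Qed.

Lemma size_split_enum P : size (split_enum P) = #|Om|.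
Proof. by rewrite size_cat -!cardE cardsC. Qed.

Lemma index_split_enum P x : (index x (split_enum P) < #|P|)%N = (x \in P).
Proof.
rewrite index_cat mem_enum; case: ifP => [xP|_]; first by rewrite cardE index_mem mem_enum.
by rewrite -cardE ltnNge leq_addr.
Qed.

Lemma perm_imset_card P Q : #|P| = #|Q| -> exists sigma, sigma @: P = Q.
Proof.
move=> PQ; pose f x := nth x (split_enum Q) (index x (split_enum P)).
have idx x : (index x (split_enum P) < size (split_enum Q))%N.
  by rewrite size_split_enum -(size_split_enum P) index_mem mem_split_enum.
have f_inj : injective f.
  move=> x y; rewrite /f (set_nth_default y) //.
  move/eqP; rewrite nth_uniq ?split_enum_uniq // => /eqP e.
  by rewrite -(nth_index x (mem_split_enum P x)) e nth_index ?mem_split_enum.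
exists (perm f_inj); apply/eqP; rewrite eqEcard card_imset; last exact: perm_inj.
rewrite PQ leqnn andbT; apply/fintype.subsetP => _ /imsetP[x xP ->].
rewrite permE -index_split_enum /f index_uniq ?split_enum_uniq //.
by rewrite -PQ index_split_enum.
Qed.

Lemma superset_card P (s : nat) : (#|P| <= s <= #|Om|)%N ->
  exists2 Q : {set Om}, P \subset Q & #|Q| = s.
Proof.
case/andP=> Ps sN; exists [set x | x \in take s (split_enum P)]%SET.
  apply/fintype.subsetP => x xP; rewrite inE.
  by rewrite in_take ?mem_split_enum // (leq_trans _ Ps) // index_split_enum.
rewrite cardsE; have /card_uniqP -> := take_uniq s (split_enum_uniq P).
by rewrite size_takel // size_split_enum.
Qed.

Variable bad : pred {set Om}.
Hypothesis bad_mono : forall P Q, P \subset Q -> bad Q -> bad P.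

Definition image_set (F : {ffun I -> Om}) : {set Om} := [set F i | i : I]%SET.

Definition bad_prob : R := avg (fun F : {ffun I -> Om} => (bad (image_set F))%:R).

(** Proportional to the probability that a uniform set of size #P is bad. Being constant on sets of
    equal size, it mediates between the two models. *)
Definition bad_perms P : R := \sum_(sigma : {perm Om}) (bad (sigma @: P))%:R.

Lemma bad_perms_card P Q : #|P| = #|Q| -> bad_perms P = bad_perms Q.
Proof.
move=> /perm_imset_card[tau <-]; rewrite /bad_perms (reindex_inj (mulgI tau)) /=.
apply: eq_bigr => sigma _; rewrite -imset_comp; congr (bad _)%:R.
by apply: eq_imset => x; rewrite permM.
Qed.

Lemma sum_bad_perms s : \sum_(P : {set Om} | #|P| == s) bad_perms P =
  #|{perm Om}|%:R * \sum_(P : {set Om} | #|P| == s) (bad P)%:R.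
Proof.
rewrite /bad_perms exchange_big /= mulr_natl -sumr_const.
apply: eq_big => // sigma _.
rewrite [RHS](reindex_inj (imset_inj (@perm_inj _ sigma))) /=.
by apply: eq_bigl => P; rewrite card_imset //; apply: perm_inj.
Qed.

(** Composing [F] with a permutation leaves its law unchanged, so [bad_prob] is also an average over
    permutations. The image of [F], of size at most #I, lies in a set [Q] of size [s], which by
    [bad_mono] is bad under no more permutations than the image. *)
Lemma bad_card_le s : (#|I| <= s <= #|Om|)%N ->
  \sum_(P : {set Om} | #|P| == s) (bad P)%:R <=
  bad_prob * #|[set P : {set Om} | #|P| == s]%SET|%:R.
Proof.
case/andP=> Is sN.
have [P0 /eqP P0s] : exists P0 : {set Om}, #|P0| = s.
  have [|Q _ <-] := @superset_card finset.set0 s; first by rewrite cards0.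
  by exists Q.
set C := #|_|%:R; set fact : R := #|{perm Om}|%:R.
have fact_gt0 : 0 < fact by rewrite ltr0n; apply/card_gt0P; exists 1%g.
have c_P0 : C * bad_perms P0 = fact * \sum_(P : {set Om} | #|P| == s) (bad P)%:R.
  rewrite -sum_bad_perms (eq_bigr (fun=> bad_perms P0)); last first.
    by move=> P /eqP Ps; apply: bad_perms_card; rewrite Ps (eqP P0s).
  by rewrite sumr_const mulr_natl /C cardsE.
have le_P0 : bad_perms P0 <= fact * bad_prob.
  (* Samples fail to exist only if [Om] is empty and [I] is not, against #I <= s <= #Om. *)
  have [Om0|Om0] := posnP #|{ffun I -> Om}|.
    exfalso; have [I0|/card_gt0P[i _]] := posnP #|I|.
      by rewrite card_ffun I0 expn0 in Om0.
    move/eqP: Om0; rewrite card_ffun expn_eq0 => /andP[/eqP Om0 I0].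
    by move: sN; rewrite Om0 leqn0 => /eqP s0; rewrite s0 leqn0 in Is; rewrite (eqP Is) in I0.
  have -> : fact * bad_prob =
     avg (fun F : {ffun I -> Om} => bad_perms (image_set F)).
    rewrite /bad_perms avg_sum /fact mulr_natl -sumr_const.
    apply: eq_big => // sigma _; rewrite /bad_prob /avg; congr (_ / _).
    pose h (F : {ffun I -> Om}) : {ffun I -> Om} := [ffun i => sigma (F i)].
    have h_inj : injective h.
      move=> F G /ffunP FG; apply/ffunP => i; have := FG i.
      by rewrite !ffunE => /perm_inj.
    rewrite (reindex_inj h_inj); apply: eq_bigr => F _; congr (bad _)%:R.
    by rewrite /image_set -imset_comp; apply: eq_imset => i; rewrite /h ffunE.
  rewrite -[leLHS](avg_cst _ Om0); apply: avg_le => F.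
  have FI : (#|image_set F| <= s <= #|Om|)%N.
    by rewrite sN andbT (leq_trans (leq_imset_card _ _)).
  have [Q FQ Qs] := superset_card FI.
  rewrite (@bad_perms_card P0 Q); last by rewrite Qs (eqP P0s).
  apply: ler_sum => sigma _; rewrite ler_nat.
  have := @bad_mono (sigma @: image_set F) (sigma @: Q) (imsetS _ FQ).
  by case: (bad (sigma @: Q)) => // ->.
rewrite -(ler_pM2l fact_gt0) -c_P0 mulrA mulrC.
by rewrite ler_wpM2r // /C ler0n.
Qed.

(** Split by the size of [P] and apply [bad_card_le] to each size. *)
Lemma bad_fraction_le (q : pred nat) : (forall s, q s -> (#|I| <= s)%N) ->
  #|[set P : {set Om} | q #|P| & bad P]%SET|%:R <=
  bad_prob * #|[set P : {set Om} | q #|P|]%SET|%:R.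
Proof.
move=> qI.
have card_sum (b : pred {set Om}) : #|[set P : {set Om} | q #|P| & b P]%SET|%:R =
  \sum_(s < #|Om|.+1 | q s) \sum_(P : {set Om} | #|P| == s) (b P)%:R :> R.
  rewrite -sum1_card natr_sum.
  rewrite (partition_big (fun P : {set Om} => inord #|P| : 'I_#|Om|.+1) q) /=; last first.
    by move=> P; rewrite inE => /andP[qP _]; rewrite inordK // ltnS max_card.
  apply: eq_bigr => s qs; rewrite big_mkcond [RHS]big_mkcond; apply: eq_bigr => P _.
  rewrite inE -val_eqE /= inordK ?ltnS ?max_card //.
  by case: eqP => [->|_]; rewrite ?andbF // andbT qs; case: (b P).
have -> : #|[set P : {set Om} | q #|P|]%SET| = #|[set P : {set Om} | q #|P| & predT P]%SET|.
  by apply: eq_card => P; rewrite !inE andbT.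
rewrite !card_sum mulr_sumr; apply: ler_sum => s qs.
apply: le_trans (bad_card_le _) _.
  by rewrite qI //= -ltnS ltn_ord.
rewrite -natr_sum sum1_card ler_wpM2l //.
  by apply: avg_ge0.
by rewrite cardsE.
Qed.

End UniformSubsets.

(** * Quotients by relators *)

Definition letter_inv (m : nat) (a : letter m) : letter m := (a.1, ~~ a.2).

Lemma letter_invK m : involutive (@letter_inv m).
Proof. by case=> i b; rewrite /letter_inv /= negbK. Qed.

(* act1 is an isometric action of the free group on m letters; unlike has_F of
   the presented quotient, this property is visibly monotone in P. *)
Definition forces_fixpoint (R : realType) (H : completeNormedModType R) (m eta : nat)
    (P : {set word m eta}) : Prop :=
  forall act1 : letter m -> H -> H,
  (forall a x, act1 (letter_inv a) (act1 a x) = x) ->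
  (forall a x y, `|act1 a x - act1 a y| = `|x - y|) ->
  (forall w, w \in P -> forall x, wact (A := letter m) act1 w x = x) ->
  exists x, forall a, act1 a x = x.

Lemma hilbert_inner_product (R : realType) (H : completeNormedModType R) :
  hilbert H -> exists dot : inner_product H, forall x, dot x x = `|x| ^+ 2.
Proof.
case=> dot dotE.
have dC x y : dot x y = dot y x by rewrite hermC expr0 mul1r.
have dDl x y z : dot (x + y) z = dot x z + dot y z by exact: linearDl.
have dZl a x y : dot (a *: x) y = a * dot x y by exact: linearZl_LR.
have d_ge0 x : 0 <= dot x x by rewrite dotE sqr_ge0.
by exists (InnerProduct dC dDl dZl d_ge0).
Qed.

Section PresentedQuotient.
Variables (R : realType) (H : completeNormedModType R) (m : nat).
Variables (Gamma : groupType) (s : 'I_m -> Gamma).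
Hypothesis s_generates : generates (range s).
Variables (eta : nat) (P : {set word m eta}).
Local Notation Q := (presented_quotient s P).
Local Notation E := (normed_metric H).
Local Notation relators := [set word_value s w | w in [set` P]].
Local Notation proj := (@quotient_map Gamma relators : Gamma -> Q).

Lemma quotient_projM x y : (proj (x * y) = proj x * proj y)%g.
Proof. exact: quotient_mapM. Qed.

Lemma quotient_proj1 : proj 1%g = 1%g.
Proof. by []. Qed.

Lemma quotient_projV x : (proj x^-1 = (proj x)^-1)%g.
Proof. exact: quotient_mapV. Qed.

Lemma quotient_proj_relator w : w \in P -> proj (word_value s w) = 1%g.
Proof.
move=> wP; apply/esym/(@quotient_mapP Gamma relators).
rewrite invg1 mul1g => N [_]; apply.
by exists w.
Qed.

(** An action of the quotient pulls back to the letters with relators acting trivially, and the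
    stabilizer in [Gamma] of a point fixed by the letters is a subgroup containing the
    generators. *)
Lemma forces_fixpoint_has_F : forces_fixpoint H P -> has_F Q E.
Proof.
move=> P_forces rho.
pose act1 (a : letter m) (x : H) : H := rho (proj (letter_value s a)) x.
have rhoM g h (x : E) : rho (g * h)%g x = rho g (rho h x) by rewrite gmulfM.
(* An idempotent bijection is the identity. *)
have rho1 (x : E) : rho 1%g x = x.
  by apply: (bij_inj (isometry_bij (rho 1%g))); rewrite -rhoM mulg1.
have wactE (w : seq (letter m)) (x : E) :
    wact act1 w x = rho (proj (\prod_(a <- w) letter_value s a)%g) x.
  elim: w => [|a w IH]; first by rewrite big_nil quotient_proj1 rho1.
  by rewrite big_cons quotient_projM rhoM /= IH.
have [||w wP x|x fix_x] := P_forces act1.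
- move=> [i b] x; rewrite /act1 -rhoM -quotient_projM /letter_inv /letter_value /=.
  by case: b => /=; rewrite ?mulgV ?mulVg quotient_proj1 rho1.
- move=> a x y; rewrite /act1 distrC [RHS]distrC.
  exact: (isometry_mdist (rho (proj (letter_value s a))) x y).
- by rewrite wactE -/(word_value s w) quotient_proj_relator // rho1.
exists x => g.
rewrite -[g](@quotient_reprK Gamma relators); set y := quotient_repr g.
pose S := [set g | rho (proj g) x = x].
suff : S y by [].
have : [set: Gamma] y by [].
rewrite -s_generates; apply; split.
  split=> [|a b|a]; rewrite /S /=.
  - by rewrite quotient_proj1 rho1.
  - by move=> Sa Sb; rewrite quotient_projM rhoM Sb Sa.
  - by move=> Sa; rewrite -[in LHS]Sa quotient_projV -rhoM mulVg rho1.
by move=> _ [i _ <-]; apply: (fix_x (i, false)).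
Qed.

End PresentedQuotient.

(** * Asymptotics *)

Section ErrorBound.
Variable R : realType.

(** e^z = (e^(z/n))^n >= (z/n)^n. This turns exponential tails into the power of [kappa] that
    Markov's inequality gives. *)
Lemma expRN_le_pow (z : R) (n : nat) : 0 < z -> expR (- z) <= n%:R ^+ n / z ^+ n.
Proof.
move=> z_gt0; have [->|n_gt0] := posnP n.
  by rewrite !expr0 divr1 -[leRHS]expR0 ler_expR oppr_le0 ltW.
have n0 : 0 < n%:R :> R by rewrite ltr0n.
have zn_gt0 : 0 < z / n%:R by rewrite divr_gt0.
have -> : n%:R ^+ n / z ^+ n = ((z / n%:R) ^+ n)^-1 by rewrite expr_div_n invf_div.
rewrite expRN lef_pV2 ?posrE ?expR_gt0 ?exprn_gt0 //.
have -> : expR z = expR (z / n%:R) ^+ n.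
  by rewrite -expRM_natl mulrC mulfVK // lt0r_neq0.
rewrite lerXn2r ?nnegrE ?expR_ge0 ?(ltW zn_gt0) //.
by apply: le_trans (expR_ge1Dx _); rewrite lerDr.
Qed.

Variables (n : nat) (L Q tau0 : R).
Hypothesis L_gt0 : 0 < L.
Hypothesis Q_gt0 : 0 < Q.
Hypothesis tau0_gt0 : 0 < tau0.

Definition error_const : R :=
  2 * (4 * Q / tau0 ^+ n + 2 * L * Q * n%:R ^+ n)
  + Q * (4 * Q / L) ^+ n * n%:R ^+ n.

Lemma error_const_ge0 : 0 <= error_const.
Proof.
have := ltW L_gt0; have := ltW Q_gt0; have := ltW tau0_gt0 => t0 q0 l0.
by rewrite /error_const !(addr_ge0, mulr_ge0, exprn_ge0, invr_ge0).
Qed.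

Lemma error_bound (nX nY q kappa tau : R) : 1 <= q -> q <= Q -> tau0 <= tau ->
  0 < nY -> 0 < kappa -> nX = nY * q ->
  2 * (2 * (nX + nY) / (tau * kappa) ^+ n + L * (nX + nY) * expR (- kappa))
    + nX * expR (- (L * kappa / q / 4)) <= error_const * (nY / kappa ^+ n).
Proof.
move=> q1 qQ tau_le nY_gt0 kappa_gt0 nXE.
have q_gt0 : 0 < q by exact: lt_le_trans q1.
have nX_gt0 : 0 < nX by rewrite nXE mulr_gt0.
have kn : 0 < kappa ^+ n by rewrite exprn_gt0.
have tn : 0 < tau0 ^+ n by rewrite exprn_gt0.
have nX_le : nX <= Q * nY by rewrite nXE mulrC ler_pM2r.
have nXY_le : nX + nY <= 2 * Q * nY.
  have : nY <= Q * nY by rewrite ler_peMl ?(ltW nY_gt0) // (le_trans q1).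
  lra.
have h1 : 2 * (nX + nY) / (tau * kappa) ^+ n <= 4 * Q / tau0 ^+ n * (nY / kappa ^+ n).
  have -> : 4 * Q / tau0 ^+ n * (nY / kappa ^+ n) =
      2 * (2 * Q * nY) / (tau0 * kappa) ^+ n.
    by rewrite exprMn; field; rewrite !lt0r_neq0.
  apply: ler_pM.
  - by rewrite mulr_ge0 // addr_ge0 // ltW.
  - by rewrite invr_ge0 exprn_ge0 // mulr_ge0 ?(le_trans (ltW tau0_gt0) tau_le) // ltW.
  - by rewrite ler_pM2l.
  - have tt : 0 < tau by exact: lt_le_trans tau_le.
    rewrite lef_pV2 ?posrE ?exprn_gt0 ?mulr_gt0 //.
    by rewrite lerXn2r ?nnegrE ?mulr_ge0 ?(ltW tt) ?(ltW tau0_gt0) ?(ltW kappa_gt0) // ler_pM2r.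
have h2 : L * (nX + nY) * expR (- kappa) <= 2 * L * Q * n%:R ^+ n * (nY / kappa ^+ n).
  have -> : 2 * L * Q * n%:R ^+ n * (nY / kappa ^+ n) =
    (L * (2 * Q * nY)) * (n%:R ^+ n / kappa ^+ n).
    by field; rewrite lt0r_neq0.
  apply: ler_pM; rewrite ?expR_ge0 //.
  - by rewrite mulr_ge0 ?addr_ge0 ?ltW.
  - by rewrite ler_pM2l.
  - exact: expRN_le_pow.
have h3 : nX * expR (- (L * kappa / q / 4)) <=
    Q * (4 * Q / L) ^+ n * n%:R ^+ n * (nY / kappa ^+ n).
  have -> : Q * (4 * Q / L) ^+ n * n%:R ^+ n * (nY / kappa ^+ n) =
     (Q * nY) * (n%:R ^+ n / (L * kappa / Q / 4) ^+ n).
    rewrite !exprMn !exprVn; field.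
    by rewrite !expf_neq0 ?lt0r_neq0.
  apply: ler_pM; rewrite ?expR_ge0 ?(ltW nX_gt0) //.
  have z_gt0 : 0 < L * kappa / Q / 4 by rewrite !divr_gt0 ?mulr_gt0.
  apply: le_trans (expRN_le_pow n z_gt0).
  rewrite ler_expR lerN2 ler_pM2r // ler_pM2l ?mulr_gt0 //.
  by rewrite lef_pV2.
rewrite /error_const.
move: (4 * Q / tau0 ^+ n) (2 * L * Q * n%:R ^+ n) (Q * (4 * Q / L) ^+ n * n%:R ^+ n)
  (nY / kappa ^+ n) h1 h2 h3 => a b c z h1 h2 h3.
by rewrite [leRHS]mulrDl -[2 * (a + b) * z]mulrA [(a + b) * z]mulrDl lerD // ler_pM2l ?lerD.
Qed.

(** The place where d > 1/3 acts: eta >= 3 l gives kappa >= c1 B^((3 d - 1) l), and n (3 d - 1) >= 2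
    then gives kappa^n >= c1^n B^(2 l). *)
Lemma inv_kappa_bound (B c1 d kappa : R) (l eta : nat) : 1 < B -> 0 < c1 ->
  2 <= n%:R * (3 * d - 1) -> 0 < d -> (3 * l <= eta)%N ->
  c1 * (B `^ (d * eta%:R) / B ^+ l) <= kappa ->
  B ^+ l / kappa ^+ n <= (c1 ^+ n)^-1 / B ^+ l.
Proof.
move=> B1 c1_gt0 nd d_gt0 leta le_kappa.
have B0 : 0 < B by exact: lt_trans B1.
have Bl : 0 < B ^+ l by rewrite exprn_gt0.
pose y := B `^ ((3 * d - 1) * l%:R).
have y_gt0 : 0 < y by rewrite powR_gt0.
have y_kappa : c1 * y <= kappa.
  apply: le_trans le_kappa; rewrite ler_pM2l // ler_pdivlMr //.
  rewrite -powR_mulrn ?(ltW B0) // -powRD; last by rewrite lt0r_neq0 ?implybT.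
  apply: ler_powR; first exact: ltW.
  have : (3 * l)%:R <= eta%:R :> R by rewrite ler_nat.
  by rewrite natrM; nra.
have yn : B ^+ l * B ^+ l <= y ^+ n.
  rewrite -exprD -powR_mulrn ?(ltW B0) // /y -[leRHS]powR_mulrn ?powR_ge0 // -powRrM.
  apply: ler_powR; first exact: ltW.
  rewrite natrD.
  have : 0 <= l%:R :> R by []. 
  nra.
have cy : (c1 * y) ^+ n <= kappa ^+ n.
  have cy_ge0 : 0 <= c1 * y by rewrite mulr_ge0 // ltW.
  by rewrite lerXn2r ?nnegrE // (le_trans cy_ge0).
have kn : 0 < kappa ^+ n.
  by apply: lt_le_trans cy; rewrite exprn_gt0 ?mulr_gt0.
have cn : 0 < c1 ^+ n by rewrite exprn_gt0.
rewrite ler_pdivrMr //.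
have -> : (c1 ^+ n)^-1 / B ^+ l * kappa ^+ n = kappa ^+ n / (c1 ^+ n * B ^+ l).
  by field; rewrite lt0r_neq0 // lt0r_neq0.
rewrite ler_pdivlMr ?mulr_gt0 //; apply: le_trans cy.
by rewrite exprMn mulrCA ler_pM2l.
Qed.

End ErrorBound.

Lemma exists_splitting eta : (7 <= eta)%N -> exists l t,
  [/\ (t <= 2)%N, (0 < l)%N, eta = (l + (l + t.*2 + l))%N,
      (3 * l <= eta)%N & (eta <= 4 * l.+1)%N].
Proof.
(* t is the residue with 2 t = eta mod 3; eta >= 7 leaves eta - 2 t >= 3, so l is positive. *)
move=> eta7; exists ((eta - 2 * (2 * eta %% 3)) %/ 3)%N, (2 * eta %% 3)%N.
by split; lia.
Qed.

(** * Choice of parameters and rate of convergence *)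

Section RandomPresentations.
Variables (R : realType) (H : completeNormedModType R) (m : nat).
Hypothesis H_hilbert : hilbert H.
Hypothesis m_ge1 : (1 <= m)%N.
Variables (c d : R).
Hypothesis c_gt1 : 1 < c.
Hypothesis d_gt : 3^-1 < d.
Hypothesis d_lt : d < 1.
Local Notation B := ((2 * m)%:R : R).

Let c_gt0 : 0 < c. Proof. exact: lt_trans c_gt1. Qed.
Let d_gt0 : 0 < d. Proof. by apply: lt_trans d_gt; rewrite invr_gt0. Qed.
Let B_ge2 : 2 <= B. Proof. by rewrite ler_nat leq_pmulr. Qed.
Let B_gt1 : 1 < B. Proof. by apply: lt_le_trans B_ge2; rewrite ltr1n. Qed.
Let B_gt0 : 0 < B. Proof. exact: lt_trans B_gt1. Qed.

Lemma card_letter : #|letter m| = (2 * m)%N.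
Proof. by rewrite card_prod card_ord card_bool mulnC. Qed.

(** Since d > 1/3 and eta >= 3 l, B^(d eta) >= B^l >= l + 1 >= eta / 4. *)
Lemma relator_count_ge eta : (7 <= eta)%N -> eta%:R / 4 <= B `^ (d * eta%:R).
Proof.
move=> eta7; have [l [t [_ _ _ leta eta_le]]] := exists_splitting eta7.
apply: (@le_trans _ _ (B ^+ l)).
  rewrite ler_pdivrMr // mulrC; apply: (@le_trans _ _ (4 * l.+1%:R)).
    by rewrite -natrM ler_nat.
  rewrite ler_pM2l // -natrX ler_nat.
  by apply: ltn_expl; rewrite -(ltr_nat R).
rewrite -powR_mulrn ?(ltW B_gt0) //; apply: ler_powR; first exact: ltW.
have : (3 * l)%:R <= eta%:R :> R by rewrite ler_nat.
have : 0 <= eta%:R :> R by [].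
have : 3 * d > 1 by move: d_gt; rewrite -[X in X < _]mul1r ltr_pdivrMr // mulrC.
rewrite natrM; nra.
Qed.

(** The window from x / c to c x has length at least 1, so it contains the first integer above x /
    c, and x / c < (2 m)^eta. *)
Lemma presentations_gt0 eta : (7 <= eta)%N ->
  (c - c^-1)^-1 <= B `^ (d * eta%:R) -> (0 < #|presentations m eta d c|)%N.
Proof.
move=> eta7; set x := B `^ _ => x_large.
have c_inv : c^-1 < 1 by rewrite invf_lt1.
have x_gt0 : 0 < x by rewrite powR_gt0.
have cx_ge0 : 0 <= c^-1 * x by rewrite mulr_ge0 ?invr_ge0 ?ltW.
have x_ge1 : 1 <= (c - c^-1) * x.
  by rewrite mulrC -ler_pdivrMr ?mul1r // subr_gt0 (lt_trans c_inv).
pose s := (Num.truncn (c^-1 * x)).+1.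
have /andP[s_le s_gt] := truncn_itv cx_ge0.
have sN : (s <= #|word m eta|)%N.
  rewrite /s truncn_lt_nat // card_tuple card_letter natrX -powR_mulrn ?(ltW B_gt0) //.
  apply: (@lt_le_trans _ _ x); first by rewrite gtr_pMl.
  by apply: ler_powR; [exact: ltW|rewrite ler_piMl ?(ltW d_lt)].
have [|P _ Ps] := @superset_card (word m eta) finset.set0 s.
  by rewrite cards0.
apply/card_gt0P; exists P; rewrite inE Ps -/x ltW //=.
rewrite /s -natr1; move: s_le; nra.
Qed.

(** [n], [L] and [tau0] are fixed before [eta], so the error is a constant times B^-l, and eta <= 4
    (l + 1) turns this into the rate 1 / eta. *)
Lemma bad_presentations_le : exists C E0 : R, forall eta, (7 <= eta)%N -> E0 <= eta%:R ->
  #|[set P in presentations m eta d c | ~~ `[< forces_fixpoint H P >]]%SET|%:R <=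
  C / eta%:R * #|presentations m eta d c|%:R /\ (0 < #|presentations m eta d c|)%N.
Proof.
have [dot dotE] := hilbert_inner_product H_hilbert.
have d3 : 0 < 3 * d - 1.
  by rewrite subr_gt0; move: d_gt; rewrite -[X in X < _]mul1r ltr_pdivrMr // mulrC.
pose s0 := Num.truncn (2 / (3 * d - 1)); pose n := (2 ^ s0)%N.
have nd : 2 <= n%:R * (3 * d - 1).
  rewrite -ler_pdivrMr //; apply: le_trans (ltW (truncnS_gt _)) _.
  by rewrite ler_nat; apply: ltn_expl.
have n_pow2 : exists s, n = (2 ^ s)%N by exists s0.
(* B^4 dominates q = B^(2 t) as t <= 2, so [tau0] is a lower bound for the gap constant. *)
pose Q : R := B ^+ 4; pose tau0 : R := (256 * Q ^+ 2)^-1.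
have Q_gt0 : 0 < Q by rewrite exprn_gt0.
have p256 : 0 < 256 :> R by rewrite ltr0n.
have tau0_gt0 : 0 < tau0 by rewrite invr_gt0 (mulr_gt0 p256) // exprn_gt0.
pose L := (Num.truncn (2 * n%:R ^+ 2 * 34 ^+ n / tau0 ^+ n)).+1.
have L_large : 2 * n%:R ^+ 2 * 34 ^+ n <= tau0 ^+ n * L%:R.
  by rewrite [leRHS]mulrC -ler_pdivrMr ?exprn_gt0 // ltW // truncnS_gt.
have L_gt0 : 0 < L%:R :> R by rewrite ltr0n.
(* The 2 pays for rounding: k is the integer part of some y >= 1, so k >= y / 2. *)
pose c1 : R := (2 * L%:R * c)^-1.
have c1_gt0 : 0 < c1 by rewrite invr_gt0 !mulr_gt0.
exists (error_const n L%:R Q tau0 * (c1 ^+ n)^-1 * 4).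
(* The first summand will make [k] positive, the second makes presentations exist; the 4 comes from
   [relator_count_ge]. *)
exists (4 * (L%:R * c + (c - c^-1)^-1)) => eta eta7 eta_large.
have c_inv : c^-1 < c by rewrite (lt_trans _ c_gt1) // invf_lt1.
have x_large : L%:R * c + (c - c^-1)^-1 <= B `^ (d * eta%:R).
  by apply: le_trans (relator_count_ge eta7); rewrite ler_pdivlMr // mulrC.
have cc_ge0 : 0 <= (c - c^-1)^-1 by rewrite invr_ge0 subr_ge0 ltW.
split; last first.
  apply: presentations_gt0 => //; apply: le_trans x_large.
  by rewrite lerDr mulr_ge0 ?ltW.
have [l [t [t2 l_gt0 etaE leta eta_le]]] := exists_splitting eta7.
set x := B `^ _ in x_large.
(* [L * k] draws do not exceed the least admissible number of relators, so a sample fits into a set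
   of any admissible size. *)
pose k := Num.truncn (c^-1 * x / L%:R).
have y_ge1 : 1 <= c^-1 * x / L%:R.
  rewrite ler_pdivlMr // mul1r ler_pdivlMl // mulrC; apply: le_trans x_large.
  by rewrite lerDl.
have /andP[k_le k_gt] := truncn_itv (le_trans ler01 y_ge1).
have k_gt0 : (0 < k)%N.
  by rewrite -ltnS -(ltr_nat R) (le_lt_trans y_ge1).
have Lk_le : (L * k)%:R <= c^-1 * x by rewrite natrM mulrC -ler_pdivlMr.
pose q s := (c^-1 * x <= s%:R <= c * x).
pose bad (P : {set word m eta}) := ~~ `[< forces_fixpoint H P >].
have bad_mono (P P' : {set word m eta}) : P \subset P' -> bad P' -> bad P.
  move=> PP'; apply: contra => /asboolP hP; apply/asboolP => act1 a1 a2 a3.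
  by apply: hP => // w wP; apply: a3; apply: (fintype.subsetP PP').
have := @bad_fraction_le R (word m eta) ('I_L * 'I_k)%type bad bad_mono q.
have -> : [set P : {set word m eta} | q #|P| & bad P]%SET =
    [set P in presentations m eta d c | ~~ `[< forces_fixpoint H P >]]%SET.
  by apply/finset.setP => P; rewrite !inE.
have -> : [set P : {set word m eta} | q #|P|]%SET = presentations m eta d c.
  by apply/finset.setP => P; rewrite !inE.
move=> frac; apply: le_trans (frac _) _.
  move=> s /andP[sx _]; rewrite card_prod !card_ord -(ler_nat R).
  exact: le_trans sx.
rewrite ler_wpM2r //.
have a0 : letter m by exact: (Ordinal m_ge1, false).
pose tau := gap_const (letter m) t R.
pose good := @good_sample (letter m) (@letter_inv m) l t eta etaE R L k n.
have B_pow j : (#|letter m|%:R : R) ^+ j = B ^+ j by rewrite card_letter.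
pose qq : R := B ^+ t.*2.
have qq1 : 1 <= qq by rewrite exprn_ege1 // ltW.
have qqQ : qq <= Q.
  by rewrite /qq /Q ler_weXn2l ?ltW // -[4%N]/(2.*2) leq_double.
have tau_le : tau0 <= tau.
  have qq0 : 0 < qq by exact: lt_le_trans qq1.
  have le_sqr : qq ^+ 2 <= Q ^+ 2 by rewrite lerXn2r // nnegrE ltW.
  rewrite /tau0 /tau /gap_const B_pow -/qq.
  move: (qq ^+ 2) (Q ^+ 2) (exprn_gt0 2 qq0) (exprn_gt0 2 Q_gt0) le_sqr => a b a0' b0 ab.
  by rewrite lef_pV2 ?posrE ?(mulr_gt0 p256) // (ler_pM2l p256).
have tau_gt0 : 0 < tau by exact: lt_le_trans tau_le.
have L_large' : 2 * n%:R ^+ 2 * 34 ^+ n <= tau ^+ n * L%:R.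
  apply: le_trans L_large _; rewrite ler_pM2r //.
  by rewrite lerXn2r ?nnegrE ?(ltW tau_gt0) ?(ltW tau0_gt0).
apply: (@le_trans _ _ (avg (fun F => (~~ good F)%:R))).
  apply: avg_le => F; rewrite ler_nat.
  suff : good F -> ~~ bad (image_set F) by case: (good F) (bad _) => [] [] // /(_ isT).
  move=> F_good; rewrite negbK; apply/asboolP => act1 act1K act1_isom triv.
  apply: (good_sample_fixpoint a0 (@letter_invK m) _ k_gt0 l_gt0 L_large' n_pow2
    dotE act1K act1_isom F_good) => //.
  by move=> p y; apply: triv; apply: imset_f.
apply: le_trans (good_sample_prob a0 (@letter_invK m) etaE R n _ k_gt0) _ => //.
pose nY : R := #|{: l.-tuple (letter m)}|%:R.
have nYE : nY = B ^+ l by rewrite /nY card_tuple natrX B_pow.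
have nY_gt0 : 0 < nY by rewrite nYE exprn_gt0.
have nXE : #|{: (l + t.*2).-tuple (letter m)}|%:R = nY * qq.
  by rewrite nYE card_tuple natrX B_pow exprD.
pose kappa := k%:R / nY.
have kappa_gt0 : 0 < kappa by apply: divr_gt0 => //; rewrite ltr0n.
have := error_bound n L_gt0 Q_gt0 tau0_gt0 qq1 qqQ tau_le nY_gt0 kappa_gt0 nXE.
have -> : L%:R * kappa / qq / 4 = mean_degree (letter m) l t R L k / 4.
  rewrite /mean_degree nXE natrM /kappa; field.
  by rewrite !lt0r_neq0 // (lt_le_trans _ qq1).
move/le_trans; apply.
rewrite -!mulrA ler_wpM2l ?error_const_ge0 // mulrA nYE.
have kappa_ge : c1 * (x / B ^+ l) <= kappa.
  rewrite mulrA /kappa nYE ler_pM2r ?invr_gt0 ?exprn_gt0 //.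
  have : c^-1 * x / L%:R < 2 * k%:R.
    apply: lt_le_trans k_gt _; rewrite mulr_natl mulr2n -natr1 lerD2l ler1n.
    exact: k_gt0.
  have -> : c1 * x = (c^-1 * x / L%:R) / 2.
    by rewrite /c1; field; rewrite !lt0r_neq0.
  by move=> h; rewrite ler_pdivrMr // [leRHS]mulrC ltW.
apply: le_trans (inv_kappa_bound B_gt1 c1_gt0 nd d_gt0 leta kappa_ge) _.
rewrite -mulrA ler_wpM2l ?invr_ge0 ?exprn_ge0 ?(ltW c1_gt0) //.
have eta_gt0 : 0 < eta%:R :> R by rewrite ltr0n (leq_trans _ eta7).
rewrite -[leLHS]mul1r ler_pdivrMr ?exprn_gt0 // mulrAC ler_pdivlMr // mul1r.
apply: (@le_trans _ _ (4 * l.+1%:R)); first by rewrite -natrM ler_nat.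
rewrite ler_pM2l // -natrX ler_nat.
by apply: ltn_expl; rewrite -(ltr_nat R).
Qed.

End RandomPresentations.

Theorem theorem7p1 (R : realType) (H : completeNormedModType R)
    (H_hilbert : hilbert H) (m : nat) (m_ge1 : (1 <= m)%N)
    (c : R) (c_gt1 : 1 < c) (Gamma : groupType) (s : 'I_m -> Gamma)
    (s_generates : generates (range s)) (d : R) (d_gt : 3^-1 < d) (d_lt : d < 1) :
  (#|[set P in presentations m eta d c |
        `[< has_F (presented_quotient s P) (normed_metric H) >]]%SET|%:R
     / #|presentations m eta d c|%:R : R) @[eta --> \oo] --> (1 : R).
Proof.
have [C [E0 bad_le]] := bad_presentations_le H_hilbert m_ge1 c_gt1 d_gt d_lt.
apply/cvgrPdist_le => e e_gt0.
have near_e := nbhs_infty_ger (C / e); have near_E0 := nbhs_infty_ger E0.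
have near_7 := nbhs_infty_ge 7.
near=> eta.
have eta7 : (7 <= eta)%N by near: eta.
have eta_gt0 : 0 < eta%:R :> R by rewrite ltr0n (leq_trans _ eta7).
have [|bad_eta pres_gt0] := bad_le eta eta7; first by near: eta.
set pres := presentations m eta d c in bad_eta pres_gt0 *.
set good := [set P in pres | _]%SET.
set bad := [set P in pres | _]%SET in bad_eta.
have pres_gt0' : 0 < #|pres|%:R :> R by rewrite ltr0n.
(* A presentation outside [bad] forces a fixed point, and so lies in [good]. *)
have pres_le : (#|pres| <= #|good| + #|bad|)%N.
  rewrite -cardsUI; apply: leq_trans (leq_addr _ _).
  apply: subset_leq_card; apply/fintype.subsetP => P Ppres.
  rewrite !inE in Ppres *; rewrite Ppres /=.
  have [P_forces|no_force] := pselect (forces_fixpoint H P).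
    by rewrite asboolT //; apply: forces_fixpoint_has_F.
  by rewrite orbC asboolF.
have good_le : (#|good| <= #|pres|)%N.
  apply: subset_leq_card; apply/fintype.subsetP => Rel.
  by rewrite inE => /andP[].
rewrite ger0_norm; last first.
  by rewrite subr_ge0 ler_pdivrMr // mul1r ler_nat.
rewrite lerBlDr -lerBlDl ler_pdivlMr // mulrBl mul1r lerBlDr.
have : #|pres|%:R <= #|good|%:R + #|bad|%:R :> R by rewrite -natrD ler_nat.
move/le_trans; apply; rewrite lerD2l; apply: le_trans bad_eta _.
rewrite ler_pM2r // ler_pdivrMr // mulrC -ler_pdivrMr //.
by near: eta.
Unshelve. all: by end_near.
Qed.
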